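(* Let $n\ge 2$. For the cyclic Nakayama algebra $\Lambda^2_n$, write $n=2k+1$ if $n$ is odd and $n=2k$ if $n$ is even, with $k\ge 1$ an integer. Then $$s(\Lambda^2_n)=\begin{cases}3k+1 & \text{if } n=2k+1,\\ 3k-1 & \text{if } n=2k,\end{cases}$$ and $$\#(\Lambda^2_n)=\begin{cases}2k+1 & \text{if } n=2k+1,\\ 2k\left(\dfrac{8^k}{12}-\dfrac{(-1)^k}{3}+1\right) & \text{if } n=2k.\end{cases}$$
   Context: Let $K$ be a field. For $n\ge 2$, $\Lambda^2_n$ denotes the selfinjective Nakayama $K$-algebra given by the cyclic quiver with vertices $1,\dots,n$ and arrows $\eta_i:i\to i+1$ for $1\le i\le n-1$ and $\eta_n:n\to 1$, modulo all paths of length $2$, so that every indecomposable projective module has length $2$. The projective $P_i$ is uniserial with top $S_i$ and socle $S_{i+1}$ (indices mod $n$). For a finite dimensional algebra $A$: a (finite dimensional) module $M$ is weak exceptional if $\mathrm{Hom}_A(M,M)\cong K$ and $\mathrm{Ext}^1_A(M,M)=0$. A pair $(M,N)$ is a weak exceptional pair if $M,N$ are weak exceptional, $\mathrm{Hom}_A(N,M)=0$ and $\mathrm{Ext}^1_A(N,M)=0$. (Higher extensions are allowed to be nonzero.) A tuple $(M_1,\dots,M_r)$ is a weak exceptional sequence (or collection) if $(M_i,M_j)$ is a weak exceptional pair for all $1\le i<j\le r$. Sequences are ordered sequences of isomorphism classes of modules. The size of such a sequence is the number of distinct modules in it. Write $s(A)$ for the supremum of the sizes of weak exceptional sequences of $A$;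 a weak exceptional sequence is full if its size equals $s(A)$; $\#(A)$ is the number of distinct full weak exceptional sequences of $A$. *)

(* Defs.v *)
From HB Require Import structures.
From mathcomp Require Import all_boot all_order all_algebra all_field.
From Stdlib Require List.

Set Implicit Arguments.
Unset Strict Implicit.
Unset Printing Implicit Defensive.

Import GRing.Theory.
Local Open Scope ring_scope.

Record quiver := Quiver {
  qvertex : finType;
  qarrow : finType;
  qsrc : qarrow -> qvertex;
  qtgt : qarrow -> qvertex;
  quiver_neq0 : (0 < #|qvertex|)%N
}.

(* The path algebra K Q modulo all paths of length 2.  It has a basis given   *)
(* by the vertices (trivial paths) and the arrows: (a, b) stands for          *)
(*   \sum_i a i * e_i + \sum_u b u * u.                                       *)
(* Products compose like functions (from right to left): an arrow u : i -> j  *)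
(* satisfies u = e_j * u * e_i, and the product of two arrows is 0.  Hence    *)
(* left modules are the representations of Q in which arrows u : i -> j act   *)
(* as maps V_i -> V_j, with all compositions of two arrows equal to 0.        *)
Definition rad2_algebra (K : fieldType) (Q : quiver) : Type :=
  ({ffun qvertex Q -> K^o} * {ffun qarrow Q -> K^o})%type.

Section Rad2Algebra.
Variables (K : fieldType) (Q : quiver).
Local Notation A := (rad2_algebra K Q).

HB.instance Definition _ := Vector.copy A
  ({ffun qvertex Q -> K^o} * {ffun qarrow Q -> K^o})%type.

Definition rad2_one : A := ([ffun => 1], [ffun => 0]).

Definition rad2_mul (x y : A) : A :=
  ([ffun i => x.1 i * y.1 i],
   [ffun u => x.1 (qtgt u) * y.2 u + x.2 u * y.1 (qsrc u)]).

Lemma rad2_mulA : associative rad2_mul.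
Proof.
move=> x y z; congr pair; apply/ffunP => i; rewrite !ffunE /= ?ffunE.
  by rewrite mulrA.
by rewrite mulrDr mulrDl !mulrA addrA.
Qed.

Lemma rad2_mul1 : left_id rad2_one rad2_mul.
Proof.
case=> a b; congr pair; apply/ffunP => i; rewrite !ffunE /= ?mul1r //.
by rewrite mul0r addr0.
Qed.

Lemma rad2_mulr1 : right_id rad2_one rad2_mul.
Proof.
case=> a b; congr pair; apply/ffunP => i; rewrite !ffunE /= ?mulr1 //.
by rewrite mulr0 add0r.
Qed.

Lemma rad2_mulDl : left_distributive rad2_mul +%R.
Proof.
move=> x y z; congr pair; apply/ffunP => i; rewrite !ffunE /= ?mulrDl //.
by rewrite addrACA.
Qed.

Lemma rad2_mulDr : right_distributive rad2_mul +%R.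
Proof.
move=> x y z; congr pair; apply/ffunP => i; rewrite !ffunE /= ?mulrDr //.
by rewrite addrACA.
Qed.

Lemma rad2_1_neq0 : rad2_one != 0.
Proof.
have /card_gt0P [i _] := quiver_neq0 Q.
apply/eqP => /(congr1 (fun x : A => x.1 i)); rewrite !ffunE.
by move/eqP; rewrite oner_eq0.
Qed.

HB.instance Definition _ := GRing.Zmodule_isNzRing.Build A
  rad2_mulA rad2_mul1 rad2_mulr1 rad2_mulDl rad2_mulDr rad2_1_neq0.

Lemma rad2_scaleAl (c : K) (x y : A) : c *: (x * y) = (c *: x) * y.
Proof.
congr pair; apply/ffunP => i; rewrite !ffunE /= ?scalerAl //.
by rewrite scalerDr !scalerAl.
Qed.

HB.instance Definition _ :=
  GRing.Lmodule_isLalgebra.Build K A rad2_scaleAl.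

Lemma rad2_scaleAr (c : K) (x y : A) : c *: (x * y) = x * (c *: y).
Proof.
congr pair; apply/ffunP => i; rewrite !ffunE /= ?scalerAr //.
by rewrite scalerDr !scalerAr.
Qed.

HB.instance Definition _ :=
  GRing.Lalgebra_isAlgebra.Build K A rad2_scaleAr.

HB.instance Definition _ := Algebra_isFalgebra.Build K A.

End Rad2Algebra.

Lemma cyclic_quiver_neq0 n (n_gt1 : (1 < n)%N) : (0 < #|'I_n|)%N.
Proof. by rewrite card_ord ltnW. Qed.

(* The arrow indexed by i goes from i to i + 1 modulo n. *)
Definition cyclic_quiver n (n_gt1 : (1 < n)%N) : quiver :=
  Quiver (fun i : 'I_n => i) (fun i : 'I_n => ordS i)
         (cyclic_quiver_neq0 n_gt1).

(* Since A e_i is spanned by e_i and by the arrow i -> i + 1, the projective  *)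
(* left module P_i = A e_i has top S_i and socle S_{i + 1}.                   *)
Definition Lambda2 (K : fieldType) n (n_gt1 : (1 < n)%N) : falgType K :=
  rad2_algebra K (cyclic_quiver n_gt1).

Section NumClasses.
Variables (T : Type) (equiv : T -> T -> Prop) (P : T -> Prop).

(* There are exactly m elements satisfying P, up to equiv. *)
Definition num_classes (m : nat) : Prop :=
  exists f : 'I_m -> T,
    [/\ forall i, P (f i),
        forall i j, equiv (f i) (f j) -> i = j
      & forall x, P x -> exists i, equiv x (f i)].

End NumClasses.

Section WeakExceptional.
Variables (K : fieldType) (A : falgType K).

(* K acts on an A-module through the structure map c |-> c%:A of A. *)
Definition finite_dimensional (M : lmodType A) : Prop :=
  exists s : seq M, forall x : M, exists c : 'I_(size s) -> K,
    x = \sum_(i < size s) (c i)%:A *: s`_i.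

Record fdmod := FdMod {
  fdmod_lmod :> lmodType A;
  fdmodP : finite_dimensional fdmod_lmod
}.

Definition mod_iso (M N : lmodType A) : Prop :=
  exists f : {linear M -> N}, bijective f.

Definition Hom_zero (M N : lmodType A) : Prop :=
  forall f : {linear M -> N}, forall x, f x = 0.

(* Hom_A(M, N) is isomorphic to K as a K-vector space.  Homomorphisms are     *)
(* compared pointwise.                                                        *)
Definition Hom_iso_K (M N : lmodType A) : Prop :=
  exists phi : K -> {linear M -> N},
    [/\ forall (c a b : K) x, phi (c * a + b) x = c%:A *: phi a x + phi b x,
        forall a b, phi a =1 phi b -> a = b
      & forall f : {linear M -> N}, exists a, f =1 phi a].

(* Short exact sequences 0 -> N -> E -> M -> 0. *)
Record extension (M N : lmodType A) := Extension {
  ext_mid : lmodType A;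
  ext_in : {linear N -> ext_mid};
  ext_out : {linear ext_mid -> M};
  ext_in_inj : injective ext_in;
  ext_out_surj : forall y, exists x, ext_out x = y;
  ext_exact : forall x, ext_out x = 0 <-> exists y, x = ext_in y
}.

(* A map f as below is automatically an isomorphism, by the five lemma. *)
Definition ext_equiv M N (X Y : extension M N) : Prop :=
  exists f : {linear ext_mid X -> ext_mid Y},
    (forall x, f (ext_in X x) = ext_in Y x) /\
    (forall x, ext_out Y (f x) = ext_out X x).

Section TrivialExtension.
Variables M N : lmodType A.

Definition triv_in (y : N) : (N * M)%type := (y, 0).
Definition triv_out (x : (N * M)%type) : M := x.2.

Lemma triv_in_linear : linear triv_in.
Proof. by move=> a x y; congr pair; rewrite /= scaler0 addr0. Qed.

Lemma triv_out_linear : linear triv_out.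
Proof. by []. Qed.

HB.instance Definition _ :=
  GRing.isLinear.Build A N (N * M)%type _ triv_in triv_in_linear.
HB.instance Definition _ :=
  GRing.isLinear.Build A (N * M)%type M _ triv_out triv_out_linear.

Lemma triv_in_inj : injective triv_in.
Proof. by move=> x y []. Qed.

Lemma triv_out_surj y : exists x, triv_out x = y.
Proof. by exists (0, y). Qed.

Lemma triv_exact x : triv_out x = 0 <-> exists y, x = triv_in y.
Proof.
split=> [|[y ->] //]; case: x => y z /= ->.
by exists y.
Qed.

Definition trivial_extension : extension M N :=
  @Extension M N (N * M)%type triv_in triv_out
    triv_in_inj triv_out_surj triv_exact.

End TrivialExtension.

(* Ext^1_A(M, N) = 0, where Ext^1_A(M, N) is the set of equivalence classes   *)
(* of extensions of M by N, with zero element the class of the direct sum.    *)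
Definition Ext1_zero (M N : lmodType A) : Prop :=
  forall X : extension M N, ext_equiv X (trivial_extension M N).

Definition weak_exceptional (M : fdmod) : Prop :=
  Hom_iso_K M M /\ Ext1_zero M M.

Definition weak_exceptional_pair (M N : fdmod) : Prop :=
  [/\ weak_exceptional M, weak_exceptional N, Hom_zero N M & Ext1_zero N M].

(* The pair condition is imposed for all positions i < j, so that every       *)
(* member of a sequence of length at least 2 is weak exceptional.             *)
Definition weak_exceptional_seq (s : seq fdmod) : Prop :=
  List.ForallOrdPairs weak_exceptional_pair s.

Definition seq_iso (s t : seq fdmod) : Prop :=
  List.Forall2 (fun M N : fdmod => mod_iso M N) s t.

(* The number of distinct (that is, pairwise nonisomorphic) modules in s. *)
Definition has_size (s : seq fdmod) (m : nat) : Prop :=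
  num_classes (fun M N : fdmod => mod_iso M N) (fun M => List.In M s) m.

Definition size_bound (b : nat) : Prop :=
  forall s m, weak_exceptional_seq s -> has_size s m -> (m <= b)%N.

(* s(A) = m *)
Definition sup_size (m : nat) : Prop :=
  size_bound m /\ forall b, size_bound b -> (m <= b)%N.

Definition full_weak_exceptional_seq (s : seq fdmod) : Prop :=
  weak_exceptional_seq s /\ exists m, sup_size m /\ has_size s m.

(* #(A) = m *)
Definition num_full (m : nat) : Prop :=
  num_classes seq_iso full_weak_exceptional_seq m.

End WeakExceptional.

(* Main.v *)
Require Import Defs.
From HB Require Import structures.
From mathcomp Require Import all_boot all_order all_algebra all_field zify ring lra.
From Stdlib Require Classical_Prop.
Set Implicit Arguments.
Unset Strict Implicit.
Unset Printing Implicit Defensive.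

(** The 2n modules that matter.  A brick over an algebra with radical square
    zero is easy to recognize, because all its endomorphisms are scalars.  If
    an arrow i -> i + 1 acts nontrivially on a brick M, a linear form that does
    not vanish on the image gives a nonzero endomorphism of M through P_i, which
    forces M to be P_i; if all arrows act by zero, a projection of rank one
    shows that M is some S_i ([brick_classification]).  For two different
    modules among the S_i and P_i, Hom or Ext^1 from the first to the second is
    nonzero exactly in four cases, which are the edges of a graph on 2n
    letters ([vmod_orthogonal]):

      P_i -> S_i,   P_(i+1) -> P_i,   S_(i+1) -> P_i,   S_i -> S_(i+1).

    Up to isomorphism, weak exceptional sequences are therefore the words
    without repetition in which the source of an edge always comes before its
    target ([admissible]), and the theorem counts the longest such words
    ([count_by_words]).

    The length.  An admissible word cannot contain a cycle of the graph.  It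
    misses a letter of each triangle P_i -> S_i -> S_(i+1) -> P_i, and it misses
    some P_i.  Let D be the set of missing P_i, and let E be the sum over all
    triangles of the number of missing letters minus one.  Counting the missing
    letters triangle by triangle, each S lying in two triangles, gives

      2 |w| + |D| + E = 3n   ([balance]).

    As |D| >= 1, this yields the bound; the longest words are those with
    |D| + E = 1 if n is odd and |D| + E = 2 if n is even.

    The words.  The missing P_i cut the cycle into arcs.  On an arc, whatever
    the set of the S present, the letters form a path of the graph, so that
    their order is forced ([chain_order], [arc_sorted]).  If E = 0, the S
    present alternate with the S missing, the two S next to a missing P being
    present ([tight_pattern]).
    - n = 2k + 1: there is one arc with the alternating pattern, hence one word
      for each missing P_i, that is n words ([odd_words]).
    - n = 2k, |D| = 1, E = 1: the S present form an independent set of k points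
      in a path of 2k points; there are k + 1 of them ([independent_pattern]),
      hence n (k + 1) words.
    - n = 2k, |D| = 2, E = 0: the two arcs have odd lengths 2a + 1 and n - 2a - 1,
      and 3a + 1 and 3(k - a) - 2 letters.  The only edges between the arcs go
      from the first letter of one to the last letter of the other, so that any
      shuffle is admissible, except for the two concatenations
      ([merge_admissible]).  Exactly one of the two missing P has an even index
      and can be called the start of the first arc.  The number a being
      determined by the number of letters of the first arc, the words are
      given by k starting points and by the binary sequences of length 3k - 1
      whose number of ones is 1 modulo 3, without 2k of them ([count_good]).

    If c is the number of those binary sequences, the total for n = 2k is
    2k (k + 1) + k (c - 2k) = 2k + k c, and Pascal's rule modulo 3 gives
    3 c = 8^k / 2 - 2 (-1)^k ([mask_count_formula]). *)

(** * Shuffles and positions in sequences *)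

(** The mask tells from which of the two sequences the next entry is taken. *)
Fixpoint shuffle T (m : bitseq) (a b : seq T) : seq T :=
  match m, a, b with
  | true :: m', x :: a', _ => x :: shuffle m' a' b
  | false :: m', _, y :: b' => y :: shuffle m' a b'
  | _, _, _ => [::]
  end.

Lemma shuffle_filter T (q : pred T) w :
  shuffle (map q w) (filter q w) (filter (predC q) w) = w.
Proof. by elim: w => //= x w IHw; case: (q x) => /=; rewrite IHw. Qed.

(** With [shuffle_filter]: for fixed sequences told apart by a predicate, masks
    and shuffles correspond bijectively. *)
Lemma filter_shuffle T (q : pred T) m a b :
  count id m = size a -> size m = size a + size b -> all q a -> all (predC q) b ->
  [/\ filter q (shuffle m a b) = a, filter (predC q) (shuffle m a b) = b
    & map q (shuffle m a b) = m].
Proof.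
elim: m a b => [|[] m IHm] [|x a] [|y b] //=; try by lia.
- move=> ma sm /andP[qx qa] qb; have [||//|//|h1 h2 h3] := IHm a [::]; rewrite /=; try lia.
  by rewrite qx /= h1 h2 h3.
- move=> ma sm /andP[qx qa] qb; have [||//|//|h1 h2 h3] := IHm a (y :: b); rewrite /=; try lia.
  by rewrite qx /= h1 h2 h3.
- move=> ma sm qa /andP[qy qb]; have [||//|//|h1 h2 h3] := IHm [::] b; rewrite /=; try lia.
  by rewrite (negPf qy) /= h1 h2 h3.
- by have := count_size id m; lia.
- move=> ma sm qa /andP[qy qb]; have [||//|//|h1 h2 h3] := IHm (x :: a) b; rewrite /=; try lia.
  by rewrite (negPf qy) /= h1 h2 h3.
Qed.

Section IndexOrder.
Variable T : eqType.
Implicit Types (w c : seq T) (r : rel T) (p : pred T).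

Lemma pairwise_index r w : uniq w ->
  pairwise r w <-> {in w &, forall x y, index x w < index y w -> r x y}.
Proof.
case: w => [|x0 w]; first by [].
set s := x0 :: w => s_uniq; split=> [/(pairwiseP x0) rP x y xs ys xy|rP].
  by have := rP _ _ _ _ xy; rewrite !nth_index //; apply; rewrite inE index_mem.
apply/(pairwiseP x0) => i j i_lt j_lt ij; apply: rP; rewrite ?mem_nth //.
by rewrite !index_uniq.
Qed.

Lemma not_pairwise r w : uniq w -> ~~ pairwise r w ->
  exists x y, [/\ x \in w, y \in w, index x w < index y w & ~~ r x y].
Proof.
move=> w_uniq nr; have [/hasP [x xw /hasP [y yw /andP[xy rxy]]]|] := boolP
  (has (fun x => has (fun y => (index x w < index y w) && ~~ r x y) w) w).
  by exists x, y.
move/hasPn=> h; case/negP: nr; apply/(pairwise_index _ w_uniq) => x y xw yw xy.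
by have /hasPn/(_ _ yw) := h _ xw; rewrite xy negbK.
Qed.

Lemma index_filter p w x y : x \in w -> y \in w -> p x -> p y ->
  (index x (filter p w) < index y (filter p w)) = (index x w < index y w).
Proof.
elim: w => //= z w IHw; rewrite !inE => xw yw px py.
have [zx|zx] := eqVneq z x.
  by subst z; rewrite px /= eqxx; case: (x == y).
have [zy|zy] := eqVneq z y.
  by subst z; rewrite py /= eqxx !ltn0.
rewrite eq_sym (negPf zx) in xw; rewrite eq_sym (negPf zy) in yw.
case: (p z) => /=; last by rewrite (IHw xw yw px py).
by rewrite (negPf zx) (negPf zy) !ltnS (IHw xw yw px py).
Qed.

(** Filtering keeps the relative order, so the ends of the filtered sequence
    bound the positions of all its entries. *)
Lemma index_ends p w a c x : uniq w -> filter p w = a :: c -> x \in w -> p x ->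
  index a w <= index x w <= index (last a c) w.
Proof.
move=> w_uniq w_c xw px.
have xc : x \in a :: c by rewrite -w_c mem_filter px.
have inw y : y \in a :: c -> (y \in w) /\ p y.
  by rewrite -w_c mem_filter => /andP[].
have c_uniq : uniq (a :: c) by rewrite -w_c filter_uniq.
have [aw pa] := inw a (mem_head _ _); have [lw pl] := inw (last a c) (mem_last _ _).
have key y z : y \in w -> p y -> z \in w -> p z ->
    (index y w <= index z w) = (index y (a :: c) <= index z (a :: c)).
  by move=> yw py zw pz; rewrite -w_c leqNgt [RHS]leqNgt index_filter.
rewrite !key // (index_last c_uniq) index_head leq0n /= -ltnS.
by move: xc; rewrite -index_mem.
Qed.
End IndexOrder.

(** * Binary masks counted modulo 3 *)

(** The masks of the two concatenations: all entries of one of the two sequences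
    come before all entries of the other. *)
Definition blocked (m : bitseq) :=
  pairwise (fun x y => y ==> x) m || pairwise implb m.
(** Number of ones: [3 a + 1] is the number of letters of an arc of length
    [2 a + 1]. *)
Definition good (m : bitseq) := (count id m %% 3 == 1) && ~~ blocked m.

Fixpoint masks N : seq bitseq :=
  if N is N'.+1 then map (cons true) (masks N') ++ map (cons false) (masks N')
  else [:: [::]].

Lemma mem_masks N m : (m \in masks N) = (size m == N).
Proof.
have cons_inj (b : bool) : injective (cons b) by move=> x y [].
elim: N m => [|N IHN] [|b m] //=; rewrite mem_cat.
  by apply/negP => /orP[] /mapP [].
rewrite eqSS -IHN; case: b; rewrite (mem_map (@cons_inj _)).
  by rewrite orbC; case: mapP => // -[].
by case: mapP => // -[].
Qed.

Lemma masks_uniq N : uniq (masks N).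
Proof.
have cons_inj (b : bool) : injective (cons b) by move=> x y [].
elim: N => //= N IHN; rewrite cat_uniq !(map_inj_uniq (@cons_inj _)) IHN andbT /=.
by apply/hasPn => m /mapP [m' _ ->]; apply/negP => /mapP [].
Qed.

Definition mask_count r N := count (fun m => count id m %% 3 == r) (masks N).

(** Pascal's rule: prepending a one shifts the residue. *)
Lemma mask_countS N :
  [/\ mask_count 0 N.+1 = mask_count 2 N + mask_count 0 N,
      mask_count 1 N.+1 = mask_count 0 N + mask_count 1 N
    & mask_count 2 N.+1 = mask_count 1 N + mask_count 2 N].
Proof.
by rewrite /mask_count /= !count_cat !count_map; split; congr (_ + _);
  apply: eq_count => m /=; lia.
Qed.

Lemma decreasing_mask m : pairwise (fun x y => y ==> x) m =
  (m == nseq (count id m) true ++ nseq (size m - count id m) false).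
Proof.
elim: m => [//|[] m IHm] /=.
  rewrite IHm (eq_all (a2 := predT)) ?all_predT /=; last by move=> b; rewrite implybT.
  by rewrite eqseq_cons subSS.
have [c0|c_gt0] := posnP (count id m).
  have m_false : m = nseq (size m) false.
    apply/all_pred1P; move/eqP: c0; rewrite -leqn0 leqNgt -has_count.
    by rewrite -all_predC; apply: sub_all => -[].
  have -> : all (fun y => y ==> false) m by rewrite m_false all_nseq orbT.
  by rewrite IHm c0 add0n !subn0 /= eqseq_cons eqxx.
rewrite (_ : all _ m = false).
  by case: (count id m) c_gt0.
by apply/negbTE; rewrite -has_predC; move: c_gt0; rewrite -has_count; apply: sub_has => -[].
Qed.

Lemma increasing_mask m : pairwise implb m =
  (m == nseq (size m - count id m) false ++ nseq (count id m) true).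
Proof.
elim: m => [//|[] m IHm] /=.
  have := count_size id m; rewrite leq_eqVlt => /orP [/eqP c_all|c_lt].
    have m_true : m = nseq (size m) true.
      by apply/all_pred1P; move/eqP: c_all; rewrite -all_count; apply: sub_all => -[].
    have -> : all (fun y => true ==> y) m by rewrite m_true all_nseq orbT.
    by rewrite IHm c_all add1n !subnn /= eqseq_cons eqxx.
  rewrite (_ : all _ m = false) /=.
    by rewrite add1n subSS; move: c_lt; rewrite -subn_gt0; case: (size m - _).
  apply/negbTE; move: c_lt; rewrite ltn_neqAle -all_count => /andP [h _].
  by apply: contra h; apply: sub_all => -[].
rewrite IHm (eq_all (a2 := predT)) ?all_predT //= add0n subSn ?count_size //.
Qed.

(** As [a < k], ones and zeros both occur in a mask with [3 a + 1] ones and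
    length [3 k - 1]; hence the two lists have no mask in common. *)
Definition blocked_masks k : seq bitseq :=
  [seq nseq (3 * a + 1) true ++ nseq (3 * (k - a) - 2) false | a <- iota 0 k] ++
  [seq nseq (3 * (k - a) - 2) false ++ nseq (3 * a + 1) true | a <- iota 0 k].

Lemma count_blocked k :
  count (fun m => (count id m %% 3 == 1) && blocked m) (masks (3 * k - 1)) = 2 * k.
Proof.
have cnt a b : count id (nseq a true ++ nseq b false) = a.
  by rewrite count_cat !count_nseq /= mul1n mul0n addn0.
have cnt' a b : count id (nseq b false ++ nseq a true) = a.
  by rewrite count_cat !count_nseq /= mul1n mul0n add0n.
transitivity (size (blocked_masks k)); last by rewrite size_cat !size_map size_iota; lia.
rewrite -size_filter; apply/perm_size/uniq_perm.
- exact/filter_uniq/masks_uniq.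
- rewrite cat_uniq !map_inj_in_uniq ?iota_uniq /=.
  + rewrite andbT; apply/hasPn => m /mapP [a]; rewrite mem_iota => a_lt ->.
    apply/negP => /mapP [a']; rewrite mem_iota => a'_lt.
    have : 0 < 3 * (k - a) - 2 by lia.
    by case: (3 * (k - a) - 2) => // d _; rewrite [3 * a' + 1]addn1.
  + by move=> a a' _ _ /(congr1 (count id)); rewrite !cnt'; lia.
  + by move=> a a' _ _ /(congr1 (count id)); rewrite !cnt; lia.
move=> m; rewrite mem_filter mem_masks mem_cat; apply/andP/orP.
  move=> [/andP[/eqP m_mod]]; rewrite /blocked decreasing_mask increasing_mask => m_b /eqP m_size.
  rewrite m_size in m_b; have c_le : count id m <= 3 * k - 1 by rewrite -m_size count_size.
  move: (count id m) m_mod c_le m_b => c m_mod c_le m_b.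
  have h1 : 3 * (c %/ 3) + 1 = c by lia.
  have h2 : 3 * (k - c %/ 3) - 2 = 3 * k - 1 - c by lia.
  have h3 : c %/ 3 \in iota 0 k by rewrite mem_iota add0n /=; lia.
  by case/orP: m_b => /eqP m_b; [left|right]; apply/mapP; exists (c %/ 3); rewrite ?h1 ?h2.
have mod_a a : (3 * a + 1) %% 3 == 1 by lia.
case=> /mapP [a]; rewrite mem_iota add0n => a_lt ->; rewrite ?cnt ?cnt' size_cat !size_nseq;
  (split; last by lia); rewrite mod_a /blocked ?decreasing_mask ?increasing_mask ?cnt ?cnt';
  rewrite size_cat !size_nseq.
  by rewrite addKn eqxx.
by rewrite addnK eqxx orbT.
Qed.

Lemma count_good k :
  count good (masks (3 * k - 1)) + 2 * k = mask_count 1 (3 * k - 1).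
Proof.
rewrite -(count_blocked k) /mask_count -[RHS]size_filter.
rewrite -[RHS](count_predC blocked) !count_filter addnC.
by congr (_ + _); apply: eq_count => m /=; rewrite andbC.
Qed.

(** A root of unity filter without roots of unity: three Pascal steps multiply
    the three counts by a fixed matrix, and [4 * 8 ^ k] is the number of masks of
    length [3 k + 2].  The terms in [odd k] encode the sign
    [(-1) ^ k] over the natural numbers. *)
Lemma mask_count_formula k :
  [/\ 3 * mask_count 1 (3 * k + 2) + 4 * odd k = 4 * 8 ^ k + 2,
      3 * mask_count 0 (3 * k + 2) + 1 = 4 * 8 ^ k + 2 * odd k
    & mask_count 2 (3 * k + 2) = mask_count 0 (3 * k + 2)].
Proof.
elim: k => [//|k [IH1 IH0 IH2]].
rewrite (_ : 3 * k.+1 + 2 = (3 * k + 2).+3) ?expnS /=; last lia.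
have [a0 a1 a2] := mask_countS (3 * k + 2).
have [b0 b1 b2] := mask_countS (3 * k + 2).+1.
have [c0 c1 c2] := mask_countS (3 * k + 2).+2.
split; lia.
Qed.
Lemma count_iotaS b m : count b (iota 1 m.+1) = count b (iota 1 m) + b m.+1.
Proof. by rewrite -(addn1 m) iotaD count_cat /= addn0 add1n addn1. Qed.

(** * Alternating patterns *)

(** The pattern takes the odd points up to [2 t] and the even points after
    that; the two neighbours [2 t] and [2 t + 1] are both left out. *)
Definition bend t m := if m <= 2 * t then odd m else ~~ odd m.

Lemma count_alternating b k : (forall m, m < k -> b (2 * m).+1 (+) b (2 * m).+2) ->
  count b (iota 1 (2 * k)) = k.
Proof.
elim: k => [|k IHk] b_alt; first by rewrite muln0.
rewrite (_ : 2 * k.+1 = (2 * k).+2) ?mulnS // !count_iotaS IHk.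
  by have := b_alt k (leqnn _); do 2 case: (b _) => //=; rewrite ?addn0 ?addn1.
by move=> m m_lt; apply/b_alt/leqW.
Qed.

Lemma count_odd k : count odd (iota 1 (2 * k)) = k.
Proof. by apply: count_alternating => m _; rewrite /= oddM /=. Qed.

Lemma count_bend t k : count (bend t) (iota 1 (2 * k)) = k.
Proof.
apply: count_alternating => m _; rewrite /bend /= oddM /=.
by case: ifP; case: ifP => //; lia.
Qed.

Lemma bend_inj k t t' : t <= k -> t' <= k ->
  (forall m, 0 < m <= 2 * k -> bend t m = bend t' m) -> t = t'.
Proof.
wlog tt' : t t' / t <= t'.
  move=> H tk t'k e; case: (leqP t t') => tt'; first exact: H.
  by symmetry; apply: H => // [|m mk]; [exact: ltnW|rewrite e].
move=> tk t'k e; apply/eqP; rewrite eqn_leq tt' leqNgt; apply/negP => lt_tt'.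
have : bend t (2 * t).+1 = bend t' (2 * t).+1 by apply: e; lia.
rewrite /bend (_ : ((2 * t).+1 <= 2 * t) = false); last lia.
by rewrite (_ : ((2 * t).+1 <= 2 * t') = true) /= ?oddM //; lia.
Qed.

(** Each pair [2 m + 1, 2 m + 2] contains at most one point, hence exactly one
    if the bound is reached; once a pair chooses its even point, the next pair
    cannot choose its odd point. *)
Lemma independent_pattern (b : pred nat) k :
  (forall m, 0 < m < 2 * k -> ~~ (b m && b m.+1)) ->
  count b (iota 1 (2 * k)) <= k /\
  (count b (iota 1 (2 * k)) = k ->
   exists2 t, t <= k & forall m, 0 < m <= 2 * k -> b m = bend t m).
Proof.
elim: k => [|k IHk] b_indep; first by split=> // _; exists 0 => // m; lia.
have [|le_k eq_k] := IHk; first by move=> m m_lt; apply: b_indep; lia.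
rewrite (_ : 2 * k.+1 = (2 * k).+2) ?mulnS // !count_iotaS.
have b12 : ~~ (b (2 * k).+1 && b (2 * k).+2) by apply: b_indep; lia.
split=> [|cnt]; first by move: b12; do 2 case: (b _) => //=; lia.
have [|t tk b_t] := eq_k; first by move: b12 cnt; do 2 case: (b _) => //=; lia.
have [b1|b1] := boolP (b (2 * k).+1); last first.
  have b2 : b (2 * k).+2 by move: b12 cnt; rewrite (negPf b1); case: (b _) => //=; lia.
  exists t => [|m m_le]; first exact: leqW.
  have [m_le'|] := leqP m (2 * k); first by apply: b_t; lia.
  rewrite /bend leq_eqVlt => /orP [/eqP <-|lt_m].
    by rewrite (negPf b1) /= oddM /=; case: ifP; lia.
  by rewrite (_ : m = (2 * k).+2) ?b2 /= ?oddM /=; last lia; case: ifP; lia.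
have b2 : b (2 * k).+2 = false by move: b12; rewrite b1; case: (b _).
have tk' : t = k.
  apply/eqP; rewrite eqn_leq tk leqNgt; apply/negP => lt_tk.
  have := b_indep (2 * k); rewrite b1 andbT b_t ?/bend; last lia.
  by case: ifP; rewrite ?oddM /=; lia.
exists k.+1 => // m m_le; rewrite /bend (_ : m <= 2 * k.+1); last lia.
have [m_le'|] := leqP m (2 * k).
  by rewrite b_t ?/bend ?tk' ?m_le' //; lia.
rewrite leq_eqVlt => /orP [/eqP <-|lt_m]; first by rewrite b1 /= oddM.
by rewrite (_ : m = (2 * k).+2) ?b2 /= ?oddM //; lia.
Qed.

(** * The precedence graph *)

(** The letter [(true, i)] stands for the projective module P_i, and the letter
    [(false, i)] for the simple module S_i. *)
Definition edge n (x y : bool * 'I_n) : bool :=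
  match x, y with
  | (true, i), (false, j) => i == j
  | (true, i), (true, j) | (false, i), (true, j) => i == ordS j
  | (false, i), (false, j) => j == ordS i
  end.

(** As in the definition of exceptional pairs, the condition forbids edges that
    go backwards; [admissible_index] and [admissibleP] turn it around. *)
Definition admissible n (w : seq (bool * 'I_n)) : bool :=
  pairwise (fun x y => (y != x) && ~~ edge y x) w.
Section Arcs.
Variables (n : nat) (n_gt1 : 1 < n).
Local Notation V := (bool * 'I_n)%type.

(** The two cases are the form in which linear arithmetic can use the cyclic
    successor. *)
Lemma ordS_cases (x : 'I_n) :
  x.+1 = n /\ ordS x = 0 :> nat \/ x.+1 < n /\ ordS x = x.+1 :> nat.
Proof.
rewrite /=; have [xn|xn] := eqVneq x.+1 n; first by left; rewrite xn modnn.
by right; have := ltn_ord x => x_lt; rewrite modn_small; lia.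
Qed.

Definition shift (i : 'I_n) m := iter m (@ordS n) i.
Arguments shift : simpl never.
(** The number of steps from [i] to [x], counted from 1 to [n]: the starting
    point has offset [n], because an arc starts after its missing projective
    and may come back to it. *)
Definition offset (i x : 'I_n) : nat := if i < x then x - i else x + n - i.

Lemma offset_cases (i x : 'I_n) :
  (i < x < n /\ offset i x = x - i) \/
  (x <= i < n /\ offset i x = x + n - i).
Proof.
by rewrite /offset; case: ltnP => ix; [left|right]; rewrite ?ix ltn_ord.
Qed.
Lemma offset_gt0 i x : 0 < offset i x.
Proof. by case: (offset_cases i x); lia. Qed.
Lemma offset_le i x : offset i x <= n.
Proof. by case: (offset_cases i x); lia. Qed.
Lemma offset_self i : offset i i = n.
Proof. by case: (offset_cases i i); lia. Qed.
Lemma offset_inj i : injective (offset i).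
Proof.
move=> x y e; suff: x = y :> nat by move/val_inj.
by case: (offset_cases i x); case: (offset_cases i y); lia.
Qed.
Lemma offset_ordS i x : x != i -> offset i (ordS x) = (offset i x).+1.
Proof.
move=> /eqP xi; have {}xi : x <> i :> nat by move/val_inj.
case: (offset_cases i x); case: (offset_cases i (ordS x)); case: (ordS_cases x); lia.
Qed.
Lemma offset_ordS_self i : offset i (ordS i) = 1.
Proof. by case: (offset_cases i (ordS i)); case: (ordS_cases i); lia. Qed.
Lemma offset_shift i m : 0 < m <= n -> offset i (shift i m) = m.
Proof.
elim: m => // -[|m] IHm m_le; first exact: offset_ordS_self.
have {}IHm : offset i (shift i m.+1) = m.+1 by apply: IHm; lia.
rewrite -[shift i _]/(ordS (shift i m.+1)) offset_ordS ?IHm //.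
by apply/eqP => e; move: IHm; rewrite e offset_self; lia.
Qed.
Lemma shift_offset i x : shift i (offset i x) = x.
Proof. by apply: (@offset_inj i); rewrite offset_shift // offset_gt0 offset_le. Qed.
Lemma shift_add i L m : shift (shift i L) m = shift i (m + L).
Proof. by rewrite /shift iterD. Qed.
Lemma eq_shift i m x : 0 < m <= n -> (x == shift i m) = (offset i x == m).
Proof.
move=> m_le; rewrite -(inj_eq (@offset_inj i)) offset_shift //.
Qed.
Lemma offset_shiftl i L x : 0 < L < n ->
  offset (shift i L) x = if L < offset i x then offset i x - L else offset i x + n - L.
Proof.
move=> L_le; have := @offset_shift i L; move: (shift i L) => j iL.
by case: (offset_cases i x); case: (offset_cases i j); case: (offset_cases j x); case: ifP; lia.
Qed.

Lemma edge_irr (x : V) : edge x x = false.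
Proof.
case: x => [[] i]; apply/negP => /= /eqP /(congr1 (@nat_of_ord n));
  by case: (ordS_cases i); lia.
Qed.

Lemma admissible_uniq (w : seq V) : admissible w -> uniq w.
Proof.
by rewrite uniq_pairwise; apply: sub_pairwise => x y /andP[]; rewrite eq_sym.
Qed.

Lemma admissible_index (w : seq V) : admissible w ->
  {in w &, forall x y, edge x y -> index x w < index y w}.
Proof.
move=> w_adm x y xw yw xy; rewrite ltnNge leq_eqVlt; apply/negP => /orP[/eqP|] yx.
  by move: xy; rewrite -(nth_index x yw) yx nth_index // edge_irr.
move/(pairwiseP x): w_adm => /(_ (index y w) (index x w)).
by rewrite !inE !index_mem !nth_index // xy andbF => /(_ yw xw yx).
Qed.

Lemma admissibleP (w : seq V) :
  uniq w -> {in w &, forall x y, edge x y -> index x w < index y w} -> admissible w.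
Proof.
case: w => // x0 w; set s := x0 :: w => s_uniq s_idx.
apply/(pairwiseP x0) => i j i_lt j_lt ij.
rewrite nth_uniq // gtn_eqF //=; apply/negP => /s_idx.
by rewrite !mem_nth // !index_uniq // => /(_ isT isT); lia.
Qed.

Definition before (w : seq V) : rel V := fun x y => index x w < index y w.
Lemma before_trans w : transitive (before w).
Proof. by move=> y x z; apply: ltn_trans. Qed.
Lemma before_irr w : irreflexive (before w).
Proof. by move=> x; apply: ltnn. Qed.
Lemma before_sorted w : uniq w -> sorted (before w) w.
Proof.
case: w => // x0 w; set s := x0 :: w => s_uniq.
apply/(sortedP x0) => i i_lt; rewrite /before !index_uniq //.
exact: ltnW.
Qed.

(** A path of the graph has only one admissible ordering, and so has its trace
    in a longer word. *)
Lemma chain_order (w c : seq V) :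
  admissible w -> sorted (@edge n) c -> {subset c <= w} -> filter (mem c) w = c.
Proof.
move=> w_adm c_path cw; have w_uniq := admissible_uniq w_adm.
have tr := @before_trans w.
apply: (irr_sorted_eq tr (@before_irr w)).
- by apply: sorted_filter (before_sorted w_uniq).
- apply: (@sub_in_sorted _ (mem w) (@edge n)) c_path; last exact/allP.
  by move=> x y xw yw; apply: admissible_index.
- by move=> x; rewrite mem_filter; apply/andb_idr/cw.
Qed.

(** * Arcs *)

(** The letters strictly between two missing projectives P_i and P_(i+L), with
    the simples S_(i+m), [0 < m <= L], selected by [b], in the only possible
    order: S_(i+L), P_(i+L-1), S_(i+L-1), ..., P_(i+1), S_(i+1). *)
Fixpoint arc_tail (i : 'I_n) (b : pred nat) L : seq V :=
  if L is L'.+1 then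
    (true, shift i L) :: nseq (b L) (false, shift i L) ++ arc_tail i b L'
  else [::].
Definition arc_word i (b : pred nat) L := nseq (b L) (false, shift i L) ++ arc_tail i b L.-1.

Lemma mem_arc_tail i b L v x : L <= n ->
  ((v, x) \in arc_tail i b L) = (offset i x <= L) && (v || b (offset i x)).
Proof.
elim: L => [|L IHL] L_le; first by rewrite in_nil leqNgt offset_gt0.
rewrite inE mem_cat mem_nseq (IHL (ltnW L_le)) !xpair_eqE !eq_shift ?L_le //.
case: v {IHL} => /=; first by rewrite andbF; lia.
by case: eqP => /= [->|]; rewrite ?lt0b ?andbF ?andbT ?orbF; lia.
Qed.

Lemma mem_arc_word i b L v x : 0 < L <= n ->
  ((v, x) \in arc_word i b L) = if v then offset i x < L else (offset i x <= L) && b (offset i x).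
Proof.
move=> L_le; rewrite mem_cat mem_nseq mem_arc_tail; last lia.
rewrite xpair_eqE eq_shift //; have := offset_gt0 i x.
case: v => /=; first by rewrite andbF; lia.
by case: eqP => /= [->|]; rewrite ?lt0b ?andbF ?andbT ?orbF; lia.
Qed.

(** Whether or not S_(i+m) is present, there is a step of the graph from
    P_(i+m) or from S_(i+m) down to P_(i+m-1). *)
Lemma arc_tail_path i b L x : edge x (true, shift i L) -> path (@edge n) x (arc_tail i b L).
Proof.
elim: L x => [|L IHL] x //= xL; rewrite xL /=.
by case: (b _) => /=; rewrite ?eqxx /= IHL //= eqxx.
Qed.
Lemma arc_sorted i b L : 0 < L -> sorted (@edge n) (arc_word i b L).
Proof.
case: L => // L _; rewrite /arc_word.
have tail_path : path (@edge n) (false, shift i L.+1) (arc_tail i b L).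
  by apply: arc_tail_path; rewrite /= eqxx.
by case: (b _) => //=; apply: path_sorted tail_path.
Qed.

Lemma size_arc_word i b L : 0 < L -> size (arc_word i b L) = L.-1 + count b (iota 1 L).
Proof.
have size_tail m : size (arc_tail i b m) = m + count b (iota 1 m).
  by elim: m => // m IHm; rewrite count_iotaS /= size_cat size_nseq IHm; lia.
case: L => // L _; rewrite count_iotaS size_cat size_nseq size_tail /=; lia.
Qed.

Lemma eq_ordS i x z : offset i z < n -> (x == ordS z) = (offset i x == (offset i z).+1).
Proof.
move=> z_lt; rewrite -(inj_eq (@offset_inj i)) offset_ordS //.
by apply: contraTneq z_lt => ->; rewrite offset_self ltnn.
Qed.

(** Inside an arc, the only edges against the order of the word are
    S_m -> S_(m+1). *)
Lemma arc_admissible i b L : 0 < L <= n ->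
  (forall m, 0 < m < L -> ~~ (b m && b m.+1)) -> admissible (arc_word i b L).
Proof.
move=> L_le b_ok.
have add_S m : m < L -> admissible (arc_tail i b m) ->
    admissible (nseq (b m.+1) (false, shift i m.+1) ++ arc_tail i b m).
  move=> m_lt m_adm; case: (boolP (b m.+1)) => //= bm.
  rewrite /admissible /= [X in _ && X]m_adm andbT.
  apply/allP => -[v x]; rewrite mem_arc_tail; last lia.
  move=> /andP[x_le x_b]; rewrite xpair_eqE eq_shift /=; last lia.
  have o_m : offset i (shift i m.+1) = m.+1 by apply: offset_shift; lia.
  case: v x_b => /= x_b; first by rewrite eq_shift; lia.
  rewrite eq_sym (@eq_ordS i) ?o_m; last lia.
  apply/andP; split; first by lia.
  apply/eqP => -[xm]; have := b_ok m; rewrite bm xm x_b; have := offset_gt0 i x; lia.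
have tail_adm m : m < L -> admissible (arc_tail i b m).
  elim: m => // m IHm m_lt; have {IHm} m_adm := add_S m (ltnW m_lt) (IHm (ltnW m_lt)).
  rewrite /admissible /= [X in _ && X]m_adm andbT.
  have o_m : offset i (shift i m.+1) = m.+1 by apply: offset_shift; lia.
  apply/allP => -[v x]; rewrite mem_cat mem_nseq mem_arc_tail; last lia.
  rewrite !xpair_eqE eq_shift /=; last lia.
  case: v => /=; rewrite ?andbF /= ?andbT => x_le.
    by rewrite (@eq_ordS i) ?o_m; lia.
  by rewrite (@eq_ordS i) ?o_m; case: eqP x_le; lia.
by case: L L_le add_S tail_adm {b_ok} => // L L_le add_S tail_adm; apply/add_S/tail_adm.
Qed.

Implicit Type w : seq V.

(** * Counting missing letters *)
Definition missing w := [set x | (true, x) \notin w].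
Definition triangle w x :=
  ((true, x) \notin w) + ((false, x) \notin w) + ((false, ordS x) \notin w).

Lemma triangle_gt0 w x : admissible w -> 0 < triangle w x.
Proof.
move=> w_adm; have idx := admissible_index w_adm.
rewrite /triangle; case: (boolP (_ \in w)) => //= Pw.
case: (boolP (_ \in w)) => //= Sw; case: (boolP (_ \in w)) => //= Sw'.
have := idx _ _ Pw Sw; have := idx _ _ Sw Sw'; have := idx _ _ Sw' Pw.
by rewrite /= !eqxx => /(_ isT) h1 /(_ isT) h2 /(_ isT) h3; lia.
Qed.

(** Otherwise P_(i+1) would precede P_i for all [i].  Summing the positions over
    the cycle turns this into [\sum (p + 1) <= \sum p]. *)
Lemma missing_gt0 w : admissible w -> 0 < #|missing w|.
Proof.
move=> w_adm; have idx := admissible_index w_adm.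
rewrite card_gt0; apply/set0Pn; apply/existsP; apply: contraT => /existsPn w_all.
have Pw x : (true, x) \in w by have := w_all x; rewrite inE negbK.
have lt_idx x : index (true, ordS x) w < index (true, x) w by apply: idx => //=.
have : \sum_(x < n) (index (true, ordS x) w).+1 <= \sum_(x < n) index (true, x) w.
  by apply: leq_sum.
rewrite [X in _ <= X](reindex_inj (@ordS_inj n)) /=.
under eq_bigr => x _ do rewrite -addn1.
rewrite big_split /= sum1_card card_ord; lia.
Qed.

Lemma card_missing w : #|missing w| = \sum_(x < n) ((true, x) \notin w).
Proof.
by rewrite -sum1_card big_mkcond; apply: eq_bigr => x _; rewrite inE; case: (_ \in _).
Qed.

Definition missing_simples w := \sum_(x < n) ((false, x) \notin w).

Lemma size_missing w : uniq w ->
  size w + #|missing w| + missing_simples w = 2 * n.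
Proof.
rewrite /missing_simples => w_uniq; rewrite -(card_uniqP w_uniq) -addnA.
rewrite card_missing.
have -> : \sum_x ((true, x) \notin w) + \sum_x ((false, x) \notin w) = #|[predC w]|.
  rewrite -sum1_card [RHS]big_mkcond /=.
  transitivity (\sum_(v : V) nat_of_bool ((v.1, v.2) \notin w)).
    by rewrite -(pair_bigA _ (fun b x => nat_of_bool ((b, x) \notin w))) big_bool.
  by apply: eq_bigr => -[b x] _; rewrite !inE; case: (_ \in _).
by apply: etrans (cardC (mem w)) _; rewrite card_prod card_bool card_ord.
Qed.

Lemma sum_triangle w :
  \sum_(x < n) triangle w x = #|missing w| + 2 * missing_simples w.
Proof.
rewrite /triangle !big_split /= -card_missing mul2n -addnn addnA; congr (_ + _).
by rewrite /missing_simples [RHS](reindex_inj (@ordS_inj n)).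
Qed.

(** Twice the number of missing letters, minus the missing projectives, is the
    sum over the triangles, because each S lies in two triangles and each P in
    one. *)
Lemma balance w : admissible w ->
  2 * size w + #|missing w| + \sum_(x < n) (triangle w x).-1 = 3 * n.
Proof.
move=> w_adm; have := size_missing (admissible_uniq w_adm); have := sum_triangle w.
have -> : \sum_(x < n) triangle w x = \sum_(x < n) (triangle w x).-1 + n.
  rewrite -[X in _ = _ + X]card_ord -sum1_card -big_split /=.
  by apply: eq_bigr => x _; rewrite addn1 prednK // triangle_gt0.
lia.
Qed.

(** If every triangle misses exactly one letter, a missing projective forces
    both simples of its triangle to be present, and each present projective
    makes exactly one of the next two simples present. *)
Lemma tight_pattern w i L : (forall x, triangle w x = 1) -> (true, i) \notin w ->
  (forall m, 0 < m < L -> (true, shift i m) \in w) ->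
  forall m, 0 < m <= L -> ((false, shift i m) \in w) = odd m.
Proof.
move=> tight iw Pw; elim=> // -[_ _|m IHm m_le].
  by have := tight i; rewrite /triangle iw -[shift i 1]/(ordS i); case: (_ \in w); case: (_ \in w).
have := tight (shift i m.+1); rewrite /triangle Pw ?IHm; try lia.
rewrite -[shift i m.+2]/(ordS (shift i m.+1)) /=.
by case: (odd m) => /=; case: (_ \in w).
Qed.

Lemma arc_in_word w i b L : admissible w -> 0 < L <= n ->
  (forall m, 0 < m < L -> (true, shift i m) \in w) ->
  (forall m, 0 < m <= L -> ((false, shift i m) \in w) = b m) ->
  filter (mem (arc_word i b L)) w = arc_word i b L.
Proof.
move=> w_adm L_le Pw Sw; apply: chain_order => //; first by apply: arc_sorted; lia.
move=> -[v x]; rewrite mem_arc_word //; have x_gt0 := offset_gt0 i x.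
case: v => [x_lt|/andP[x_le x_b]]; rewrite -(shift_offset i x).
  by apply: Pw; rewrite x_gt0.
by rewrite Sw ?x_gt0.
Qed.

Lemma missingP w x : ((true, x) \in w) = (x \notin missing w).
Proof. by rewrite inE negbK. Qed.

(** With a single missing projective, the arc goes once around the cycle. *)
Lemma one_arc w i b : admissible w -> missing w = [set i] ->
  (forall m, 0 < m <= n -> ((false, shift i m) \in w) = b m) ->
  w = arc_word i b n.
Proof.
move=> w_adm w_i Sw; have n_gt0 : 0 < n by lia.
rewrite -(@arc_in_word w i b n) //; last 2 first.
- by rewrite n_gt0 leqnn.
- move=> m m_lt; rewrite missingP w_i inE eq_sym eq_shift ?offset_self; lia.
symmetry; apply/all_filterP/allP => -[v x] xw; rewrite inE mem_arc_word ?n_gt0 //=.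
case: v xw => xw.
  rewrite ltn_neqAle offset_le andbT -[X in _ != X](offset_self i) (inj_eq (@offset_inj i)).
  by move: xw; rewrite missingP w_i inE.
by rewrite offset_le -Sw ?shift_offset // offset_gt0 offset_le.
Qed.

Lemma mem_two_arcs i L (b : pred nat) v x : 0 < L < n ->
  ((v, x) \in arc_word (shift i L) b (n - L)) =
  if v then L < offset i x < n else (L < offset i x) && b (offset i x - L).
Proof.
move=> L_lt; rewrite mem_arc_word; last lia.
rewrite offset_shiftl //; have := offset_le i x; have := offset_gt0 i x.
case: v; case: (ltnP L (offset i x)) => /=; lia.
Qed.

Lemma two_arcs w i L b b' : admissible w -> 0 < L < n ->
  missing w = [set i; shift i L] ->
  (forall m, 0 < m <= L -> ((false, shift i m) \in w) = b m) ->
  (forall m, 0 < m <= n - L -> ((false, shift (shift i L) m) \in w) = b' m) ->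
  filter (mem (arc_word i b L)) w = arc_word i b L /\
  filter (predC (mem (arc_word i b L))) w = arc_word (shift i L) b' (n - L).
Proof.
move=> w_adm L_lt w_i Sw Sw'.
have arcP m : 0 < m < n -> m != L -> (true, shift i m) \in w.
  move=> m_lt mL; rewrite missingP w_i !inE eq_sym.
  by rewrite eq_shift ?offset_self ?eq_shift ?offset_shift; lia.
split; first by apply: arc_in_word => //; [lia|move=> m m_lt; apply: arcP; lia].
rewrite -[RHS](@arc_in_word w (shift i L) b' (n - L)) //; last 2 first.
- by lia.
- by move=> m m_lt; rewrite shift_add; apply: arcP; lia.
apply: eq_in_filter => -[v x] xw; rewrite !inE /= mem_two_arcs //.
rewrite mem_arc_word; last lia.
have := offset_le i x; have := offset_gt0 i x => o_gt0 o_le.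
case: v xw => xw.
  have : offset i x != n /\ offset i x != L.
    move: xw; rewrite missingP w_i !inE eq_shift -?(inj_eq (@offset_inj i)) ?offset_self; last lia.
    by case/norP.
  lia.
case: (ltnP L (offset i x)) => oL.
  rewrite -Sw' ?shift_add ?subnK ?shift_offset ?xw //=; lia.
by rewrite -Sw ?shift_offset ?xw ?o_gt0.
Qed.

(** * Shuffles of two arcs *)

(** All other edges leaving the first arc end in the missing projective P_i at
    its start. *)
Lemma cross_edge i L (b b' : pred nat) x y : 0 < L < n ->
  x \in arc_word i b L -> y \in arc_word (shift i L) b' (n - L) -> edge x y ->
  x = (false, shift i L) /\ y = (false, shift i L.+1).
Proof.
move=> L_lt; case: x y => [v x] [v' y]; rewrite mem_arc_word ?mem_two_arcs //; last lia.
case: v => [x_lt|/andP[x_le _]]; case: v' => [/andP[y_gt y_lt]|/andP[y_gt _]] /=.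
- by rewrite (@eq_ordS i) // => /eqP; lia.
- by move=> /eqP xy; rewrite xy in x_lt; lia.
- by rewrite (@eq_ordS i) // => /eqP; lia.
move=> /eqP y_x; move: y_gt; have o_x : offset i (ordS x) = (offset i x).+1.
  by apply/eqP; rewrite -eq_ordS //; lia.
rewrite y_x o_x => o_gt; have oL : offset i x = L by lia.
by rewrite -[shift i L.+1]/(ordS (shift i L)) -oL shift_offset.
Qed.

Lemma shift_n i : shift i n = i.
Proof. by rewrite -{2}(shift_offset i i) offset_self. Qed.

Lemma last_arc i (b : pred nat) L z : 0 < L -> b 1 -> last z (arc_word i b L) = (false, shift i 1).
Proof.
move=> L_gt0 b1; have last_tail m z' : last z' (arc_tail i b m.+1) = (false, shift i 1).
  elim: m z' => [|m IHm] z' /=; first by rewrite b1.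
  by rewrite last_cat -[LHS]/(last _ (arc_tail i b m.+1)) IHm.
by case: L L_gt0 => [|[|L]] // _; rewrite /arc_word last_cat ?last_tail //= b1.
Qed.

Lemma arc_head i (b : pred nat) L : b L -> arc_word i b L = (false, shift i L) :: arc_tail i b L.-1.
Proof. by rewrite /arc_word => ->. Qed.

Lemma arc_disjoint i L (b b' : pred nat) x : 0 < L < n ->
  x \in arc_word (shift i L) b' (n - L) -> x \notin arc_word i b L.
Proof.
move=> L_lt; case: x => v x; rewrite mem_two_arcs // mem_arc_word; last lia.
by case: v; lia.
Qed.

Lemma odd_arc_admissible i L : 0 < L <= n -> admissible (arc_word i odd L).
Proof. by move=> L_le; apply: arc_admissible => // m _ /=; case: (odd m). Qed.

Section Merge.
Variables (i : 'I_n) (L : nat) (w : seq V).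
Hypotheses (L_lt : 0 < L < n) (L_odd : odd L) (L'_odd : odd (n - L)).
Let inA := mem (arc_word i odd L).
Hypotheses (w_uniq : uniq w) (wA : filter inA w = arc_word i odd L).
Hypothesis (wB : filter (predC inA) w = arc_word (shift i L) odd (n - L)).

Let L_le : 0 < L <= n. Proof. by lia. Qed.
Let L'_le : 0 < n - L <= n. Proof. by lia. Qed.
Let L'_lt : 0 < n - L < n. Proof. by lia. Qed.
Let L'_L : n - L + L = n. Proof. by lia. Qed.
Let LL' : n - (n - L) = L. Proof. by lia. Qed.

Let j := shift i L.
Let headA : V := (false, shift i L).
Let lastA : V := (false, shift i 1).
Let headB : V := (false, i).
Let lastB : V := (false, shift i L.+1).

Let wA_cons : filter inA w = headA :: arc_tail i odd L.-1.
Proof. by rewrite wA arc_head. Qed.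
Let wB_cons : filter (predC inA) w = headB :: arc_tail j odd (n - L).-1.
Proof. by rewrite wB arc_head // shift_add subnK ?shift_n //; lia. Qed.
Let lastA_E : last headA (arc_tail i odd L.-1) = lastA.
Proof. by have := @last_arc i odd L headA; rewrite arc_head //=; apply => //; lia. Qed.
Let lastB_E : last headB (arc_tail j odd (n - L).-1) = lastB.
Proof.
rewrite -[LHS]/(last headB (headB :: arc_tail j odd (n - L).-1)) -wB_cons wB.
by rewrite last_arc // ?shift_add ?add1n //; lia.
Qed.

Let sides x : x \in w ->
  if inA x then x \in arc_word i odd L else x \in arc_word (shift i L) odd (n - L).
Proof.
move=> xw; case: ifP => xA; first by rewrite -wA mem_filter xw andbT.
by rewrite -wB mem_filter xw andbT; apply/negbT.
Qed.

(** There are two edges between the arcs, from the first letter of each to the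
    last letter of the other.  Such an edge is respected as soon as some letter
    of the first arc precedes some letter of the second one, since then the
    extreme letters do so too. *)
Lemma merge_admissible :
  admissible w =
  ~~ pairwise (fun x y => inA y ==> inA x) w && ~~ pairwise (fun x y => inA x ==> inA y) w.
Proof.
have AB : edge headA lastB by rewrite /= eqxx.
have BA : edge headB lastA by rewrite /= eqxx.
have memA x : x \in filter inA w -> x \in w /\ inA x by rewrite mem_filter => /andP[].
have memB x : x \in filter (predC inA) w -> x \in w /\ ~~ inA x by rewrite mem_filter => /andP[].
have [hAw hA] : headA \in w /\ inA headA by apply: memA; rewrite wA_cons mem_head.
have [hBw hB] : headB \in w /\ ~~ inA headB by apply: memB; rewrite wB_cons mem_head.
have [lAw lA] : lastA \in w /\ inA lastA by apply: memA; rewrite wA_cons -lastA_E mem_last.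
have [lBw lB] : lastB \in w /\ ~~ inA lastB by apply: memB; rewrite wB_cons -lastB_E mem_last.
apply/idP/andP => [w_adm|[]].
  have idx := admissible_index w_adm; split; apply/negP => /(pairwise_index _ w_uniq).
    by move=> /(_ _ _ hBw lAw (idx _ _ hBw lAw BA)); rewrite lA (negPf hB).
  by move=> /(_ _ _ hAw lBw (idx _ _ hAw lBw AB)); rewrite hA (negPf lB).
move=> /(not_pairwise w_uniq) [b1 [a1 [b1w a1w b1a1]]].
rewrite negb_imply => /andP[a1A b1B].
move=> /(not_pairwise w_uniq) [a2 [b2 [a2w b2w a2b2]]].
rewrite negb_imply => /andP[a2A b2B].
apply: admissibleP => // x y xw yw xy.
have := sides xw; have := sides yw.
have [xA|xB] := boolP (inA x); have [yA|yB] := boolP (inA y) => yc xc.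
- rewrite -(index_filter (p := inA)) // wA.
  exact: (admissible_index (odd_arc_admissible _ L_le) xc yc xy).
- have [-> ->] := cross_edge L_lt xc yc xy.
  have /andP[a_le _] := index_ends w_uniq wA_cons a2w a2A.
  have /andP[_] := index_ends w_uniq wB_cons b2w b2B; rewrite lastB_E => b_le.
  exact: leq_ltn_trans a_le (leq_trans a2b2 b_le).
- have := cross_edge (i := shift i L) L'_lt xc.
  rewrite !shift_add addSn L'_L shift_n LL' -[shift i n.+1]/(ordS (shift i n)) shift_n.
  move=> /(_ _ _ yc xy) [-> ->].
  have /andP[b_le _] := index_ends w_uniq wB_cons b1w b1B.
  have /andP[_] := index_ends w_uniq wA_cons a1w a1A; rewrite lastA_E => a_le.
  exact: leq_ltn_trans b_le (leq_trans b1a1 a_le).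
- rewrite -(index_filter (p := predC inA)) // wB.
  exact: (admissible_index (odd_arc_admissible _ L'_le) xc yc xy).
Qed.
End Merge.

(** * The longest words *)
Lemma tight_of_balance w : \sum_(x < n) (triangle w x).-1 = 0 -> admissible w ->
  forall x, triangle w x = 1.
Proof.
move=> /eqP; rewrite sum_nat_eq0 => /forallP E0 w_adm x.
by have := E0 x; have := triangle_gt0 x w_adm; case: (triangle w x) => [|[]].
Qed.

Lemma missing_arc i b : missing (arc_word i b n) = [set i].
Proof.
have n_le : 0 < n <= n by lia.
apply/setP => x; rewrite !inE mem_arc_word // ltn_neqAle offset_le andbT negbK.
by rewrite -[X in _ == X](offset_self i) (inj_eq (@offset_inj i)).
Qed.

Lemma one_arc_odd w : admissible w -> #|missing w| = 1 ->
  \sum_(x < n) (triangle w x).-1 = 0 -> exists i, w = arc_word i odd n.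
Proof.
move=> w_adm /eqP /cards1P [i w_i] E0; exists i; apply: one_arc => // m m_le.
apply: (@tight_pattern w i n (tight_of_balance E0 w_adm)) => //.
  by rewrite missingP w_i inE eqxx.
by move=> m' m'_lt; rewrite missingP w_i inE eq_sym eq_shift ?offset_self; lia.
Qed.

Lemma odd_words k w : n = 2 * k + 1 ->
  admissible w && (size w == 3 * k + 1) <-> exists i, w = arc_word i odd n.
Proof.
move=> n_k; split=> [/andP[w_adm /eqP w_size]|[i ->]].
  by apply: one_arc_odd; have := balance w_adm; have := missing_gt0 w_adm; rewrite ?w_size; lia.
rewrite odd_arc_admissible ?size_arc_word; try lia.
rewrite n_k addn1 count_iotaS count_odd /= oddM /=; lia.
Qed.

Lemma size_odd_arc_word j L : odd L -> size (arc_word j odd L) = L.-1 + L./2.+1.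
Proof.
move=> L_odd; rewrite size_arc_word; last by case: L L_odd.
rewrite -{2}(odd_double_half L) L_odd add1n count_iotaS -mul2n count_odd /= oddM /=; lia.
Qed.

Section Even.
Variable k : nat.
Hypothesis n_k : n = 2 * k.

Definition one_arc_word i t : seq V := arc_word i (bend t) n.
(** The length [2 a + 1] of the arc with [3 a + 1] letters, if [3 a + 1] is the
    number of ones of the mask. *)
Definition cut (m : bitseq) := 2 * (count id m %/ 3) + 1.
Definition two_arc_word i m : seq V :=
  shuffle m (arc_word i odd (cut m)) (arc_word (shift i (cut m)) odd (n - cut m)).

Lemma bend_indep t m : ~~ (bend t m && bend t m.+1).
Proof. by rewrite /bend; case: ifP; case: ifP => /=; lia. Qed.

Lemma one_arc_word_ok i t :
  admissible (one_arc_word i t) && (size (one_arc_word i t) == 3 * k - 1).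
Proof.
rewrite arc_admissible ?size_arc_word //=; try lia.
  by rewrite [in iota _ _]n_k count_bend; lia.
by move=> m _; apply: bend_indep.
Qed.

Section TwoArcWord.
Variables (i : 'I_n) (m : bitseq).
Hypotheses (m_size : size m = 3 * k - 1) (m_mod : count id m %% 3 = 1).

Lemma cut_lt : 0 < cut m < n.
Proof. by rewrite /cut; have := count_size id m; lia. Qed.
Lemma cut_odd : odd (cut m).
Proof. by rewrite /cut oddD oddM. Qed.
Lemma cut'_odd : odd (n - cut m).
Proof. by rewrite oddB ?cut_odd ?n_k ?oddM //; have := cut_lt; lia. Qed.

Lemma two_arc_wordE (w := two_arc_word i m) :
  [/\ filter (mem (arc_word i odd (cut m))) w = arc_word i odd (cut m),
     filter (predC (mem (arc_word i odd (cut m)))) w = arc_word (shift i (cut m)) odd (n - cut m)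
   & map (mem (arc_word i odd (cut m))) w = m].
Proof.
have c_lt := cut_lt.
apply: filter_shuffle.
- by rewrite size_odd_arc_word ?cut_odd // /cut; lia.
- by rewrite !size_odd_arc_word ?cut_odd ?cut'_odd // m_size; move: c_lt cut_odd; rewrite n_k; lia.
- by apply/allP.
- by apply/allP => x; apply: arc_disjoint.
Qed.

Lemma mem_two_arc_word x : x \in two_arc_word i m =
  (x \in arc_word i odd (cut m)) || (x \in arc_word (shift i (cut m)) odd (n - cut m)).
Proof.
have [wA wB _] := two_arc_wordE.
by rewrite -{1}wA -{1}wB !mem_filter /= -andb_orl orbN.
Qed.

Lemma two_arc_word_uniq : uniq (two_arc_word i m).
Proof.
have [wA wB _] := two_arc_wordE; have c_lt := cut_lt.
rewrite -(perm_uniq (permEl (perm_filterC (mem (arc_word i odd (cut m))) _))) wA wB cat_uniq.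
rewrite !(admissible_uniq (odd_arc_admissible _ _)) ?andbT; try lia.
by apply/hasPn => x; apply: arc_disjoint.
Qed.

Lemma two_arc_word_size : size (two_arc_word i m) = 3 * k - 1.
Proof. by have [_ _ wm] := two_arc_wordE; rewrite -m_size -[in RHS]wm size_map. Qed.

Lemma two_arc_word_admissible : admissible (two_arc_word i m) = ~~ blocked m.
Proof.
have [wA wB wm] := two_arc_wordE.
rewrite (merge_admissible cut_lt cut_odd cut'_odd two_arc_word_uniq wA wB).
have blockedE (q : pred V) w b : map q w = b -> blocked b =
    pairwise (fun x y => q y ==> q x) w || pairwise (fun x y => q x ==> q y) w.
  by move=> <-; rewrite /blocked !pairwise_map.
by rewrite (blockedE _ _ _ wm) negb_or.
Qed.

Lemma missing_two_arc_word : missing (two_arc_word i m) = [set i; shift i (cut m)].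
Proof.
have c_lt := cut_lt; apply/setP => x; rewrite !inE mem_two_arc_word mem_two_arcs //.
rewrite mem_arc_word ?eq_shift; try lia.
rewrite -(inj_eq (@offset_inj i)) offset_self; have := offset_le i x; lia.
Qed.
End TwoArcWord.

Lemma even_max w : admissible w -> size w <= 3 * k - 1.
Proof. by move=> w_adm; have := balance w_adm; have := missing_gt0 w_adm; lia. Qed.

(** Parity makes sense on the cycle because [n] is even. *)
Lemma odd_shift i L : 0 < L < n -> odd (shift i L) = odd i (+) odd L.
Proof.
move=> L_lt; have := @offset_shift i L.
by case: (offset_cases i (shift i L)); lia.
Qed.

Lemma missing2_word w : admissible w -> size w = 3 * k - 1 -> #|missing w| = 2 ->
  exists (i : 'I_n) m, [/\ ~~ odd i, size m = 3 * k - 1, good m & w = two_arc_word i m].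
Proof.
move=> w_adm w_size w_2; have E0 : \sum_(x < n) (triangle w x).-1 = 0.
  by have := balance w_adm; rewrite w_size w_2; lia.
have tight := tight_of_balance E0 w_adm.
have [i [L [w_i i_even L_lt L_odd]]] : exists (i : 'I_n) L,
    [/\ missing w = [set i; shift i L], ~~ odd i, 0 < L < n & odd L].
  move/eqP: w_2 => /cards2P [x [y [xy w_xy]]].
  pose L := offset x y; have yL : y = shift x L by rewrite shift_offset.
  have L_lt : 0 < L < n.
    rewrite offset_gt0 ltn_neqAle offset_le andbT -[X in _ != X](offset_self x).
    by rewrite (inj_eq (@offset_inj x)) eq_sym.
  have L_odd : odd L.
    rewrite -(@tight_pattern w x L tight); last lia.
    - have := tight y; rewrite -yL /triangle missingP w_xy !inE eqxx orbT /=.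
      by case: (_ \in w).
    - by rewrite missingP w_xy !inE eqxx.
    move=> m m_lt; rewrite missingP w_xy !inE eq_sym eq_shift ?offset_self; last lia.
    by rewrite yL eq_sym eq_shift ?offset_shift; lia.
  (* If the arc starts at an odd index, exchange the two arcs. *)
  have [x_odd|x_even] := boolP (odd x); last by exists x, L; rewrite -yL.
  exists y, (n - L); rewrite {2}yL shift_add subnK; last lia.
  rewrite shift_n setUC w_xy; split=> //; last by rewrite oddB ?n_k ?oddM //; lia.
    by rewrite yL odd_shift // x_odd L_odd.
  lia.
have i_miss : (true, i) \notin w by rewrite missingP w_i !inE eqxx.
have j_miss : (true, shift i L) \notin w by rewrite missingP w_i !inE eqxx orbT.
have inP m : 0 < m < n -> m != L -> (true, shift i m) \in w.
  move=> m_lt mL; rewrite missingP w_i !inE eq_sym eq_shift ?offset_self; last lia.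
  by rewrite eq_shift ?offset_shift; lia.
have patA : forall m, 0 < m <= L -> ((false, shift i m) \in w) = odd m.
  by apply: tight_pattern => // m m_lt; apply: inP; lia.
have patB : forall m, 0 < m <= n - L -> ((false, shift (shift i L) m) \in w) = odd m.
  by apply: tight_pattern => // m m_lt; rewrite shift_add; apply: inP; lia.
have [wA wB] := two_arcs w_adm L_lt w_i patA patB.
pose m := map (mem (arc_word i odd L)) w; exists i, m.
have m_size : size m = 3 * k - 1 by rewrite size_map.
have m_count : count id m = L.-1 + L./2.+1.
  transitivity (size (filter (mem (arc_word i odd L)) w)).
    by rewrite size_filter count_map; apply: eq_count.
  by rewrite wA size_odd_arc_word.
have m_mod : count id m %% 3 = 1 by lia.
have cut_m : cut m = L by rewrite /cut; lia.
have w_m : w = two_arc_word i m.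
  by rewrite /two_arc_word cut_m -{1}wA -wB shuffle_filter.
by split=> //; rewrite /good m_mod -(two_arc_word_admissible i m_size m_mod) -w_m.
Qed.

Lemma missing1_word w : admissible w -> size w = 3 * k - 1 -> #|missing w| = 1 ->
  exists i t, t <= k /\ w = one_arc_word i t.
Proof.
move=> w_adm w_size /eqP /cards1P [i w_i].
pose b m := (false, shift i m) \in w.
have w_arc : w = arc_word i b n by apply: one_arc.
have [|_ b_bend] := @independent_pattern b k.
  move=> m m_lt; have := triangle_gt0 (shift i m) w_adm.
  rewrite /triangle missingP w_i inE eq_sym eq_shift ?offset_self; last lia.
  rewrite -[ordS (shift i m)]/(shift i m.+1) /b.
  rewrite (_ : (n == m) = false); last lia.
  by do 2 case: (_ \in w).
have [|t tk b_t] := b_bend.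
  have := w_size; rewrite {1}w_arc size_arc_word ?[in iota _ _]n_k; lia.
exists i, t; split=> //; apply: one_arc => // m m_le.
by rewrite -b_t // -n_k.
Qed.

(** The two missing projectives of a word of the second kind have indices of
    different parity; asking [i] to be even makes the description unique. *)
Definition even_words : seq (seq V) :=
  [seq one_arc_word i t | i <- enum 'I_n, t <- iota 0 k.+1] ++
  [seq two_arc_word i m | i <- [seq i : 'I_n <- enum 'I_n | ~~ odd i],
                          m <- [seq m <- masks (3 * k - 1) | good m]].

Lemma mem_even_words w :
  (w \in even_words) = admissible w && (size w == 3 * k - 1).
Proof.
rewrite mem_cat; apply/orP/andP => [[]|[w_adm /eqP w_size]].
- by move=> /allpairsP [[i t] [_ _ ->]]; apply/andP/one_arc_word_ok.
- move=> /allpairsP [[i m] /= [_]]; rewrite mem_filter mem_masks.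
  move=> /andP[/andP[/eqP m_mod m_free] /eqP m_size] ->.
  by rewrite two_arc_word_admissible // m_free two_arc_word_size.
have := balance w_adm; have := missing_gt0 w_adm; rewrite w_size => D_gt0 D_le.
have [D1|D2] : #|missing w| = 1 \/ #|missing w| = 2 by lia.
  left; have [i [t [tk ->]]] := missing1_word w_adm w_size D1.
  by apply/allpairsP; exists (i, t); rewrite mem_enum mem_iota.
right; have [i [m [i_even m_size m_good ->]]] := missing2_word w_adm w_size D2.
apply/allpairsP; exists (i, m); split=> //=.
  by rewrite mem_filter i_even mem_enum.
by rewrite mem_filter m_good mem_masks m_size eqxx.
Qed.

Lemma one_arc_word_inj i i' t t' : t <= k -> t' <= k ->
  one_arc_word i t = one_arc_word i' t' -> (i, t) = (i', t').
Proof.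
have n_le : 0 < n <= n by lia.
move=> tk t'k e; have i_i' : i = i'.
  apply: set1_inj; rewrite -(missing_arc i (bend t)) -(missing_arc i' (bend t')).
  by rewrite [arc_word i _ n]e.
subst i'; congr pair; apply: (@bend_inj k) => // m m_le.
have m_n : 0 < m <= n by lia.
have := mem_arc_word i (bend t) false (shift i m) n_le.
rewrite [arc_word _ _ _]e mem_arc_word // offset_shift //.
by case/andP: m_n => _ ->.
Qed.

Lemma two_arc_word_inj (i i' : 'I_n) m m' : ~~ odd i -> ~~ odd i' ->
  size m = 3 * k - 1 -> size m' = 3 * k - 1 ->
  count id m %% 3 = 1 -> count id m' %% 3 = 1 ->
  two_arc_word i m = two_arc_word i' m' -> (i, m) = (i', m').
Proof.
move=> i_even i'_even m_size m'_size m_mod m'_mod e.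
have c_lt := cut_lt m_size m_mod; have c'_lt := cut_lt m'_size m'_mod.
have e_missing : [set i; shift i (cut m)] = [set i'; shift i' (cut m')].
  by rewrite -!missing_two_arc_word // e.
have j_odd : odd (shift i (cut m)) by rewrite odd_shift // cut_odd (negPf i_even).
have j'_odd : odd (shift i' (cut m')) by rewrite odd_shift // cut_odd (negPf i'_even).
have i_i' : i = i'.
  have : i \in [set i'; shift i' (cut m')] by rewrite -e_missing !inE eqxx.
  rewrite !inE => /orP[/eqP //|/eqP i_j']; by move: i_even; rewrite i_j' j'_odd.
subst i'; have c_c' : cut m = cut m'.
  have : shift i (cut m) \in [set i; shift i (cut m')] by rewrite -e_missing !inE eqxx orbT.
  rewrite !inE => /orP[/eqP j_i|/eqP j_j']; first by move: i_even; rewrite -{1}j_i j_odd.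
  have := offset_shift i (m := cut m); rewrite j_j' offset_shift; lia.
congr pair; have [_ _ <-] := two_arc_wordE i m_size m_mod.
by have [_ _ <-] := two_arc_wordE i m'_size m'_mod; rewrite c_c' e.
Qed.

Lemma even_words_uniq : uniq even_words.
Proof.
rewrite cat_uniq; apply/and3P; split.
- apply: allpairs_uniq; rewrite ?enum_uniq ?iota_uniq // => -[i t] [i' t'].
  move=> /allpairsP [[i1 t1] [_ t1k [-> ->]]] /allpairsP [[i2 t2] [_ t2k [-> ->]]] /=.
  by move: t1k t2k; rewrite !mem_iota; apply: one_arc_word_inj.
- apply/hasPn => w /allpairsP [[i m] [_ /= m_in ->]]; apply/negP => w_one.
  have /allpairsP [[i' t] [_ _ /= e]] : two_arc_word i m \in
    [seq one_arc_word i t | i <- enum 'I_n, t <- iota 0 k.+1] by [].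
  move: m_in; rewrite mem_filter mem_masks => /andP[/andP[/eqP m_mod _] /eqP m_size].
  have := missing_arc i' (bend t); rewrite -[arc_word _ _ _]e missing_two_arc_word // => e1.
  have := cards1 i'; rewrite -e1 cards2; case: eqP => // i_j.
  have := offset_shift i (m := cut m); rewrite -i_j offset_self.
  by have := cut_lt m_size m_mod; lia.
- apply: allpairs_uniq; first exact/filter_uniq/enum_uniq; first exact/filter_uniq/masks_uniq.
  move=> -[i m] [i' m'].
  move=> /allpairsP [[i1 m1] [/= i1_in m1_in [-> ->]]].
  move=> /allpairsP [[i2 m2] [/= i2_in m2_in [-> ->]]].
  move: i1_in i2_in m1_in m2_in; rewrite !mem_filter !mem_masks.
  move=> /andP[i1_even _] /andP[i2_even _] /andP[/andP[/eqP m1_mod _] /eqP m1_size].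
  move=> /andP[/andP[/eqP m2_mod _] /eqP m2_size] /=.
  exact: two_arc_word_inj.
Qed.

Lemma size_even_words :
  size even_words = 2 * k * k.+1 + k * count good (masks (3 * k - 1)).
Proof.
rewrite size_cat !size_allpairs size_iota size_enum_ord -n_k !size_filter; congr (_ + _ * _).
rewrite -[LHS](count_map val (fun x => ~~ odd x)) val_enum_ord n_k.
elim: (k) => // j IHj; rewrite (_ : 2 * j.+1 = 2 * j + 2); last lia.
by rewrite iotaD count_cat IHj add0n /= oddM /= addn1.
Qed.
End Even.
End Arcs.

Import GRing.Theory.
Local Open Scope ring_scope.

(** * Module isomorphisms and split extensions *)
Section LinearMaps.
Variables (R : nzRingType) (U V : lmodType R).

Definition linear_map (f : U -> V) (f_lin : linear f) : {linear U -> V} :=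
  HB.pack f (GRing.isLinear.Build R U V *:%R f f_lin).

Lemma inverse_linear (f : {linear U -> V}) (g : V -> U) :
  cancel f g -> cancel g f -> linear g.
Proof. by move=> fK gK a x y; apply: (can_inj fK); rewrite linearP !gK. Qed.
End LinearMaps.

Lemma mod_iso_sym (R : nzRingType) (U V : lmodType R) (f : {linear U -> V}) :
  bijective f -> exists g : {linear V -> U}, cancel f g /\ cancel g f.
Proof. by case=> g fK gK; exists (linear_map (inverse_linear fK gK)). Qed.

Section Extensions.
Variables (K : fieldType) (A : falgType K) (M N : lmodType A) (X : extension M N).

Lemma ext_out_in y : ext_out X (ext_in X y) = 0.
Proof. by apply: (proj2 (@ext_exact _ _ _ _ X _)); exists y. Qed.

Lemma split_by_retraction (r : {linear ext_mid X -> N}) :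
  cancel (ext_in X) r -> ext_equiv X (trivial_extension M N).
Proof.
move=> rK; have f_lin : linear (fun z => (r z, ext_out X z) : (N * M)%type).
  by move=> a y z; rewrite !linearP.
exists (linear_map f_lin); split=> z //=; congr pair => //.
  exact: ext_out_in.
Qed.

Lemma split_by_section (s : {linear M -> ext_mid X}) :
  cancel s (ext_out X) -> ext_equiv X (trivial_extension M N).
Proof.
move=> sK; have kerP z : exists y, z - s (ext_out X z) == ext_in X y.
  have /ext_exact [y ->] : ext_out X (z - s (ext_out X z)) = 0; last by exists y.
  by rewrite linearB sK subrr.
pose r z := xchoose (kerP z).
have rP z : ext_in X (r z) = z - s (ext_out X z) by rewrite (eqP (xchooseP (kerP z))).
have r_lin : linear r.
  move=> a y z; apply: (@ext_in_inj _ _ _ _ X).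
  by rewrite linearP !rP [ext_out X _]linearP [s _]linearP scalerBr opprD addrACA.
apply: (@split_by_retraction (linear_map r_lin)) => y /=.
by apply: (@ext_in_inj _ _ _ _ X); rewrite rP ext_out_in linear0 subr0.
Qed.

End Extensions.

Section Transport.
Variables (K : fieldType) (A : falgType K).
Implicit Types M N : lmodType A.

Lemma mod_iso_refl (M : lmodType A) : mod_iso M M.
Proof. by exists idfun, idfun. Qed.

Lemma mod_iso_trans (M N L : lmodType A) : mod_iso M N -> mod_iso N L -> mod_iso M L.
Proof. by move=> [f fb] [g gb]; exists (g \o f); apply: bij_comp. Qed.

Lemma mod_isoC (M N : lmodType A) : mod_iso M N -> mod_iso N M.
Proof. by move=> [f /mod_iso_sym [g [fK gK]]]; exists g, f. Qed.
Lemma Hom_zero_iso M M' N N' :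
  mod_iso M M' -> mod_iso N N' -> Hom_zero M N -> Hom_zero M' N'.
Proof.
move=> [f /mod_iso_sym [f' [fK f'K]]] [g [g' gK g'K]] MN0 u x.
by have := MN0 (linear_map (inverse_linear gK g'K) \o u \o f) (f' x);
  rewrite /= f'K => /(congr1 g); rewrite g'K linear0.
Qed.

Lemma Ext1_zero_iso M M' N N' :
  mod_iso M M' -> mod_iso N N' -> Ext1_zero M N -> Ext1_zero M' N'.
Proof.
move=> [f /mod_iso_sym [f' [fK f'K]]] [g [g' gK g'K]] MN0 X'.
have in_inj : injective (ext_in X' \o g : N -> _).
  by apply: inj_comp; [apply: ext_in_inj|apply: can_inj gK].
have out_surj y : exists x, (f' \o ext_out X') x = y.
  by have [x /= e] := ext_out_surj X' (f y); exists x; rewrite /= e fK.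
have exact x : (f' \o ext_out X') x = 0 <-> exists y, x = (ext_in X' \o g) y.
  split=> [/= /(congr1 f)|[y ->]].
    rewrite f'K linear0 => /ext_exact [y ->]; exists (g' y).
    by rewrite /= g'K.
  by rewrite /= ext_out_in linear0.
have [t [t_in t_out]] := MN0 (Extension in_inj out_surj exact).
have t'_lin : linear (fun x => (g (t x).1, f (t x).2) : (N' * M')%type).
  by move=> a x y; rewrite linearP /= !linearP.
exists (linear_map t'_lin); split=> x /=.
  by have := t_in (g' x); rewrite /= g'K => ->; rewrite /= linear0 g'K.
by have := congr1 f (t_out x); rewrite /= f'K.
Qed.

(** An isomorphism of End(M) with K is only given as a bijective linear map; it
    need not preserve the identity.  The preimage of the identity is nonzero,
    since M is, and dividing by it shows that every endomorphism is a scalar. *)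
Lemma brick_endo M : Hom_iso_K M M ->
  (exists x : M, x != 0) /\
  forall f : {linear M -> M}, exists c : K, forall x, f x = c%:A *: x.
Proof.
case=> phi [phi_lin phi_inj phi_surj].
have phi0 x : phi 0 x = 0.
  by have := phi_lin (-1) 0 0 x; rewrite mulN1r addr0 oppr0 !scaleN1r addNr.
have [a a1] := phi_surj (idfun : {linear M -> M}).
have a0 : a != 0 -> forall f : {linear M -> M}, exists c : K, forall x, f x = c%:A *: x.
  move=> a0 f; have [b fb] := phi_surj f; exists (b / a) => x.
  have := phi_lin (b / a) a 0 x.
  by rewrite divfK // addr0 -fb phi0 addr0 -a1.
have nz : ~ forall x : M, x = 0.
  move=> M0; have /phi_inj/eqP : phi 0 =1 phi 1 by move=> x; rewrite [RHS]M0 phi0.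
  by rewrite eq_sym oner_eq0.
split; first by apply: Classical_Prop.NNPP => nx; apply: nz => x;
  apply/eqP; case: eqP => // /eqP x0; case: nx; exists x.
apply: a0; apply/eqP => a0; apply: nz => x.
by have := a1 x; rewrite /= a0 phi0.
Qed.
End Transport.

(** * The algebra, its simple and its projective modules *)
Section Algebra.
Variables (K : fieldType) (n : nat) (n_gt1 : (1 < n)%N).
Local Notation A := (Lambda2 K n_gt1).

Definition vcoef (a : A) (i : 'I_n) : K := a.1 i.
Definition acoef (a : A) (i : 'I_n) : K := a.2 i.

Lemma elt_eq (a b : A) : vcoef a =1 vcoef b -> acoef a =1 acoef b -> a = b.
Proof.
by case: a b => [a1 a2] [b1 b2] h1 h2; congr pair; apply/ffunP=> i; [apply: h1|apply: h2].
Qed.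

Lemma vcoefM a b i : vcoef (a * b) i = vcoef a i * vcoef b i.
Proof. by rewrite /vcoef ffunE. Qed.
Lemma acoefM a b i :
  acoef (a * b) i = vcoef a (ordS i) * acoef b i + acoef a i * vcoef b i.
Proof. by rewrite /vcoef /acoef ffunE. Qed.
Lemma vcoefD a b i : vcoef (a + b) i = vcoef a i + vcoef b i.
Proof. by rewrite /vcoef ffunE. Qed.
Lemma acoefD a b i : acoef (a + b) i = acoef a i + acoef b i.
Proof. by rewrite /acoef ffunE. Qed.
Lemma vcoefZ c a i : vcoef (c *: a) i = c * vcoef a i.
Proof. by rewrite /vcoef ffunE. Qed.
Lemma acoefZ c a i : acoef (c *: a) i = c * acoef a i.
Proof. by rewrite /acoef ffunE. Qed.
Lemma vcoef1 i : vcoef 1 i = 1.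
Proof. by rewrite /vcoef ffunE. Qed.
Lemma acoef1 i : acoef 1 i = 0.
Proof. by rewrite /acoef ffunE. Qed.

(** The basis of the algebra: trivial paths and arrows. *)
Definition idem (i : 'I_n) : A := ([ffun j : 'I_n => (j == i)%:R], [ffun=> 0]).
Definition arr (i : 'I_n) : A := ([ffun=> 0], [ffun j : 'I_n => (j == i)%:R]).
Lemma vcoef_idem i j : vcoef (idem i) j = (j == i)%:R.
Proof. by rewrite /vcoef ffunE. Qed.
Lemma acoef_idem i j : acoef (idem i) j = 0.
Proof. by rewrite /acoef ffunE. Qed.
Lemma vcoef_arr i j : vcoef (arr i) j = 0.
Proof. by rewrite /vcoef ffunE. Qed.
Lemma acoef_arr i j : acoef (arr i) j = (j == i)%:R.
Proof. by rewrite /acoef ffunE. Qed.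
Definition coefsE := (vcoefM, acoefM, vcoefD, acoefD, vcoefZ, acoefZ, vcoef1, acoef1,
  vcoef_idem, acoef_idem, vcoef_arr, acoef_arr).

(** The four products below are all that is needed to check that maps from and
    to simple and projective modules are linear. *)
Lemma mul_idemr a i : a * idem i = vcoef a i *: idem i + acoef a i *: arr i.
Proof.
apply: elt_eq => j; rewrite !coefsE ?mulr0 ?add0r ?addr0;
  by case: eqP => [->|]; rewrite ?mulr1 ?mulr0.
Qed.

Lemma mul_arrr a i : a * arr i = vcoef a (ordS i) *: arr i.
Proof.
apply: elt_eq => j; rewrite !coefsE ?mulr0 ?add0r ?addr0 //;
  by case: eqP => [->|]; rewrite ?mulr1 ?mulr0.
Qed.

Lemma mul_ideml a i :
  idem (ordS i) * a = vcoef a (ordS i) *: idem (ordS i) + acoef a i *: arr i.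
Proof.
apply: elt_eq => j; rewrite !coefsE ?mul0r ?mulr0 ?add0r ?addr0.
  by case: eqP => [->|]; rewrite ?mulr1 ?mulr0 ?mul0r ?mul1r.
by rewrite (inj_eq (@ordS_inj n)); case: eqP => [->|]; rewrite ?mulr1 ?mulr0 ?mul0r ?mul1r.
Qed.

Lemma mul_arrl a i : arr i * a = vcoef a i *: arr i.
Proof.
apply: elt_eq => j; rewrite !coefsE ?mul0r ?mulr0 ?add0r ?addr0 //;
  by case: eqP => [->|]; rewrite ?mulr1 ?mulr0 ?mul0r ?mul1r.
Qed.

Lemma ordS_neq (i : 'I_n) : (ordS i == i) = false.
Proof.
apply/negP => /eqP /(congr1 (@nat_of_ord n)); case: (ordS_cases n_gt1 i); lia.
Qed.

(** The carrier does not mention [i], which only selects the action. *)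
Definition simple_mod (i : 'I_n) : Type := K.
HB.instance Definition _ i := GRing.Zmodule.copy (simple_mod i) K.
Definition simple_act i (a : A) (x : simple_mod i) : simple_mod i := vcoef a i * (x : K).
Fact simple_actA i a b x : @simple_act i a (simple_act b x) = simple_act (a * b) x.
Proof. by rewrite /simple_act vcoefM mulrA. Qed.
Fact simple_act1 i : left_id 1 (@simple_act i).
Proof. by move=> x; rewrite /simple_act vcoef1 mul1r. Qed.
Fact simple_actDr i : right_distributive (@simple_act i) +%R.
Proof. by move=> a x y; rewrite /simple_act mulrDr. Qed.
Fact simple_actDl i x : {morph (@simple_act i)^~ x : a b / a + b}.
Proof. by move=> a b; rewrite /simple_act vcoefD mulrDl. Qed.
HB.instance Definition _ i := GRing.Zmodule_isLmodule.Build A (simple_mod i)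
  (@simple_actA i) (@simple_act1 i) (@simple_actDr i) (@simple_actDl i).

Definition proj_mod (i : 'I_n) : Type := (K * K)%type.
HB.instance Definition _ i := GRing.Zmodule.copy (proj_mod i) (K * K)%type.
(** The first coordinate is the top, at vertex [i], and the second one is the
    socle, at vertex [i + 1]. *)
Definition proj_act i (a : A) (x : proj_mod i) : proj_mod i :=
  (vcoef a i * x.1, acoef a i * x.1 + vcoef a (ordS i) * x.2).
Fact proj_actA i a b x : @proj_act i a (proj_act b x) = proj_act (a * b) x.
Proof.
by rewrite /proj_act /= !coefsE; congr pair; ring.
Qed.
Fact proj_act1 i : left_id 1 (@proj_act i).
Proof. by case=> x y; rewrite /proj_act !vcoef1 acoef1 !mul1r mul0r add0r. Qed.
Fact proj_actDr i : right_distributive (@proj_act i) +%R.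
Proof. by move=> a x y; rewrite /proj_act /= !mulrDr addrACA. Qed.
Fact proj_actDl i x : {morph (@proj_act i)^~ x : a b / a + b}.
Proof. by move=> a b; rewrite /proj_act !vcoefD acoefD !mulrDl addrACA. Qed.
HB.instance Definition _ i := GRing.Zmodule_isLmodule.Build A (proj_mod i)
  (@proj_actA i) (@proj_act1 i) (@proj_actDr i) (@proj_actDl i).

Lemma simple_scaleE i (a : A) (x : simple_mod i) : a *: x = (vcoef a i * (x : K) : K).
Proof. by []. Qed.
Lemma proj_scaleE i (a : A) (x : proj_mod i) :
  a *: x = (vcoef a i * x.1, acoef a i * x.1 + vcoef a (ordS i) * x.2).
Proof. by []. Qed.

End Algebra.

Section ActionMaps.
Variables (K : fieldType) (n : nat) (n_gt1 : (1 < n)%N).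
Local Notation A := (Lambda2 K n_gt1).
Local Notation e := (@idem K n n_gt1).
Local Notation h := (@arr K n n_gt1).
Local Notation S := (@simple_mod K n).
Local Notation P := (@proj_mod K n).

Lemma idem_idem i j : e i * e j = if i == j then e i else 0.
Proof.
rewrite mul_idemr !coefsE scale0r addr0 eq_sym.
by case: eqP => [->|]; rewrite ?scale1r ?scale0r.
Qed.
Lemma arr_idem i j : h i * e j = if i == j then h i else 0.
Proof. by rewrite mul_arrl coefsE eq_sym; case: eqP => _; rewrite ?scale1r ?scale0r. Qed.
Lemma idem_arr i j : e j * h i = if ordS i == j then h i else 0.
Proof. by rewrite mul_arrr coefsE eq_sym; case: eqP => _; rewrite ?scale1r ?scale0r. Qed.
Lemma arr_arr i j : h i * h j = 0.
Proof. by rewrite mul_arrl coefsE scale0r. Qed.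
Lemma sum_idem : \sum_i e i = 1.
Proof.
apply: elt_eq => j.
  rewrite coefsE /vcoef (_ : (_ : A).1 j = \sum_i vcoef (e i) j).
    rewrite (bigD1 j) //= coefsE eqxx big1 ?addr0 // => i /negPf.
    by rewrite coefsE eq_sym => ->.
  by elim/big_rec2: _ => [|i x y _ <-]; rewrite /vcoef ffunE.
rewrite coefsE /acoef (_ : (_ : A).2 j = \sum_i acoef (e i) j).
  by rewrite big1 // => i; rewrite coefsE.
by elim/big_rec2: _ => [|i x y _ <-]; rewrite /acoef ffunE.
Qed.

(** A folded form of the scalar action, which keeps the unifier from looking for
    scalar multiplications inside the algebra. *)
Definition Kscale (M : lmodType A) (c : K) (x : M) : M := c%:A *: x.
Local Notation "c *k x" := (Kscale c x) (at level 40).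

Section Maps.
Variable M : lmodType A.

Lemma Kscale_comm (c : K) (a : A) (x : M) : a *: (c *k x) = c *k (a *: x).
Proof. by rewrite /Kscale !scalerA mulr_algl mulr_algr. Qed.
Lemma scale_Kscale (c : K) (a : A) (x : M) : (c *: a) *: x = c *k (a *: x).
Proof. by rewrite /Kscale scalerA mulr_algl. Qed.
Lemma KscaleA (c d : K) (x : M) : c *k (d *k x) = (c * d) *k x.
Proof. by rewrite /Kscale scalerA mulr_algl scalerA. Qed.
Lemma KscaleDl (c d : K) (x : M) : (c + d) *k x = c *k x + d *k x.
Proof. by rewrite /Kscale -!scalerDl. Qed.
Lemma KscaleDr (c : K) (x y : M) : c *k (x + y) = c *k x + c *k y.
Proof. exact: scalerDr. Qed.
Lemma Kscale0 (x : M) : 0 *k x = 0.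
Proof. by rewrite /Kscale !scale0r. Qed.
Lemma Kscale1 (x : M) : 1 *k x = x.
Proof. by rewrite /Kscale !scale1r. Qed.
Lemma Kscaler0 (c : K) : c *k (0 : M) = 0.
Proof. exact: scaler0. Qed.

Lemma scale_idemr (a : A) i (x : M) :
  a *: (e i *: x) = vcoef a i *k (e i *: x) + acoef a i *k (h i *: x).
Proof. by rewrite scalerA mul_idemr scalerDl !scale_Kscale. Qed.
Lemma scale_arrr (a : A) i (x : M) : a *: (h i *: x) = vcoef a (ordS i) *k (h i *: x).
Proof. by rewrite scalerA mul_arrr scale_Kscale. Qed.
Lemma scale_ideml (a : A) i (x : M) : e (ordS i) *: (a *: x) =
  vcoef a (ordS i) *k (e (ordS i) *: x) + acoef a i *k (h i *: x).
Proof. by rewrite scalerA mul_ideml scalerDl !scale_Kscale. Qed.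
Lemma scale_arrl (a : A) i (x : M) : h i *: (a *: x) = vcoef a i *k (h i *: x).
Proof. by rewrite scalerA mul_arrl scale_Kscale. Qed.

Definition Klinear (phi : M -> K) :=
  forall (c : K) x y, phi (c *k x + y) = c * phi x + phi y.

Section KlinearTheory.
Variables (phi : M -> K) (phi_lin : Klinear phi).
Lemma Klinear0 : phi 0 = 0.
Proof. by have := phi_lin (-1) 0 0; rewrite Kscaler0 addr0 mulN1r addNr. Qed.
Lemma KlinearD x y : phi (x + y) = phi x + phi y.
Proof. by have := phi_lin 1 x y; rewrite Kscale1 mul1r. Qed.
Lemma KlinearZ c x : phi (c *k x) = c * phi x.
Proof. by have := phi_lin c x 0; rewrite Klinear0 !addr0. Qed.
End KlinearTheory.

Section FromSimple.
Variables (i : 'I_n) (x : M) (ex : e i *: x = x) (hx : h i *: x = 0).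
Lemma scale_simple (a : A) : a *: x = vcoef a i *k x.
Proof. by rewrite -[in a *: x]ex scale_idemr ex hx Kscaler0 addr0. Qed.
Fact of_simple_linear : linear (fun s : S i => (s : K) *k x).
Proof.
move=> a s t; rewrite KscaleDl; congr (_ + _).
by rewrite simple_scaleE Kscale_comm scale_simple KscaleA mulrC.
Qed.
Definition of_simple := linear_map of_simple_linear.
Lemma of_simpleE (s : S i) : of_simple s = (s : K) *k x.
Proof. by []. Qed.
End FromSimple.

(** The universal property of P_i = A e_i: maps to M correspond to e_i M. *)
Section FromProj.
Variables (i : 'I_n) (x : M) (ex : e i *: x = x).
Lemma scale_top (a : A) : a *: x = vcoef a i *k x + acoef a i *k (h i *: x).
Proof. by rewrite -[in a *: x]ex scale_idemr ex. Qed.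
Fact of_proj_linear :
  linear (fun s : P i => s.1 *k x + s.2 *k (h i *: x)).
Proof.
move=> a s t; rewrite proj_scaleE /= !KscaleDl [LHS]addrACA.
rewrite [a *: (_ + _)]scalerDr !Kscale_comm (scale_top a) scale_arrr KscaleDr !KscaleA.
by rewrite ![_ * s.1]mulrC [_ * s.2]mulrC !addrA.
Qed.
Definition of_proj := linear_map of_proj_linear.
Lemma of_projE (s : P i) : of_proj s = s.1 *k x + s.2 *k (h i *: x).
Proof. by []. Qed.
End FromProj.

(** P_i is also the injective hull of S_(i+1): maps from M to P_i correspond to
    linear forms on e_(i+1) M. *)
Section ToProj.
Variables (i : 'I_n) (phi : M -> K) (phi_lin : Klinear phi).
Fact to_proj_linear :
  linear (fun z : M => (phi (h i *: z), phi (e (ordS i) *: z)) : P i).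
Proof.
move=> a x y; rewrite proj_scaleE /= 2!scalerDr scale_arrl scale_ideml.
rewrite !phi_lin; congr pair.
by rewrite -addrA phi_lin (KlinearD phi_lin) (KlinearZ phi_lin) !addrA [_ + acoef _ _ * _]addrC.
Qed.
Definition to_proj := linear_map to_proj_linear.
Lemma to_projE z : to_proj z = (phi (h i *: z), phi (e (ordS i) *: z)) :> P i.
Proof. by []. Qed.
End ToProj.
End Maps.

Lemma idem_simple i j (s : S j) : e i *: s = if j == i then s else 0.
Proof.
rewrite simple_scaleE coefsE; case: eqP => _; first by rewrite mul1r.
by rewrite mul0r.
Qed.
Lemma arr_simple i j (s : S j) : h i *: s = 0.
Proof. by rewrite simple_scaleE coefsE mul0r. Qed.
Lemma idem_proj i j (s : P j) :
  e i *: s = (if j == i then s.1 else 0, if ordS j == i then s.2 else 0).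
Proof.
rewrite proj_scaleE !coefsE mul0r add0r.
by do 2! case: eqP => _; rewrite ?mul1r ?mul0r.
Qed.
Lemma arr_proj i j (s : P j) : h i *: s = (0, if j == i then s.1 else 0).
Proof.
rewrite proj_scaleE !coefsE !mul0r addr0.
by case: eqP => _; rewrite ?mul1r ?mul0r.
Qed.
Lemma Kscale_simple (c : K) i (s : S i) : c *k s = (c * (s : K) : K).
Proof. by rewrite /Kscale simple_scaleE !coefsE mulr1. Qed.
Lemma Kscale_proj (c : K) i (s : P i) : c *k s = (c * s.1, c * s.2).
Proof. by rewrite /Kscale proj_scaleE !coefsE mulr0 mulr1 mul0r add0r. Qed.

Lemma linearK (M N : lmodType A) (f : {linear M -> N}) c x : f (c *k x) = c *k f x.
Proof. exact: linearZ. Qed.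

(** The generator of P_i. *)
Definition top i : P i := (1, 0).
Lemma idem_top i : e i *: top i = top i.
Proof. by rewrite idem_proj eqxx /= ; case: ifP. Qed.

Lemma linear_simpleE (M : lmodType A) i (f : {linear S i -> M}) (s : S i) :
  f s = (s : K) *k f (1 : K).
Proof. by rewrite -linearK Kscale_simple mulr1. Qed.
Lemma linear_projE (M : lmodType A) i (f : {linear P i -> M}) (s : P i) :
  f s = s.1 *k f (top i) + s.2 *k (h i *: f (top i)).
Proof.
rewrite -linearZ -!linearK -linearD Kscale_proj arr_proj eqxx Kscale_proj /=.
by congr (f _); case: s => s1 s2; congr pair; rewrite /= ?mulr0 ?mulr1 ?addr0 ?add0r.
Qed.
Lemma linear_simple_idem (M : lmodType A) i (f : {linear S i -> M}) :
  e i *: f (1 : K) = f (1 : K).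
Proof. by rewrite -linearZ idem_simple eqxx. Qed.
Lemma linear_simple_arr (M : lmodType A) i j (f : {linear S i -> M}) :
  h j *: f (1 : K) = 0.
Proof. by rewrite -linearZ arr_simple linear0. Qed.
Lemma linear_top_idem (M : lmodType A) i (f : {linear P i -> M}) :
  e i *: f (top i) = f (top i).
Proof. by rewrite -linearZ idem_top. Qed.
End ActionMaps.

Section Bases.
Variables (K : fieldType) (n : nat) (n_gt1 : (1 < n)%N).
Local Notation A := (Lambda2 K n_gt1).
Local Notation "c *k x" := (Kscale c x) (at level 40).

Lemma Kscale_sum (M : lmodType A) I (r : seq I) (Q : pred I) c (F : I -> M) :
  c *k (\sum_(i <- r | Q i) F i) = \sum_(i <- r | Q i) c *k F i.
Proof. exact: scaler_sumr. Qed.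

Lemma KscaleN1 (M : lmodType A) (x : M) : (-1) *k x = - x.
Proof. by rewrite /Kscale !scaleN1r. Qed.

(** By induction on the number of generators: a linear relation allows one of
    them to be dropped. *)
Lemma exists_basis (M : lmodType A) (r : nat) (v : 'I_r -> M) :
  (forall x, exists c : 'I_r -> K, x = \sum_i c i *k v i) ->
  exists r' (w : 'I_r' -> M),
    (forall x, exists c : 'I_r' -> K, x = \sum_i c i *k w i) /\
    (forall c : 'I_r' -> K, \sum_i c i *k w i = 0 -> forall i, c i = 0).
Proof.
elim: r v => [|r IHr] v v_span; first by exists 0%N, v; split=> // c _ [].
have [[c [c0 [i ci]]]|v_free] := Classical_Prop.classic
  (exists c : 'I_r.+1 -> K, \sum_i c i *k v i = 0 /\ exists i, c i != 0); last first.
  exists r.+1, v; split=> // c c0 i; apply/eqP; case: eqP => // /eqP ci.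
  by case: v_free; exists c; split=> //; exists i.
apply: (IHr (fun j => v (lift i j))) => x; have [d ->] := v_span x.
exists (fun j => d (lift i j) - d i / c i * c (lift i j)).
rewrite (bigD1_ord i) //= in c0 *; rewrite (bigD1_ord i) //=.
have vi : v i = (- (c i)^-1) *k \sum_j c (lift i j) *k v (lift i j).
  move/eqP: c0; rewrite addrC addr_eq0 => /eqP ->.
  by rewrite -[- (c i *k v i)]KscaleN1 !KscaleA mulrN1 opprK mulVf // Kscale1.
rewrite [in d i *k _]vi KscaleA Kscale_sum -big_split /=; apply: eq_bigr => j _.
by rewrite KscaleA -KscaleDl; congr (_ *k _); ring.
Qed.

Lemma exists_functional (M : lmodType A) (y : M) : finite_dimensional M -> y != 0 ->
  exists2 phi : M -> K, Klinear phi & phi y = 1.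
Proof.
move=> [s s_span] y0.
have [r [v [v_span v_free]]] := exists_basis s_span.
have coordP x : exists c : {ffun 'I_r -> K}, x == \sum_i c i *k v i.
  have [c ->] := v_span x; exists (finfun c); apply/eqP.
  by apply: eq_bigr => i _; rewrite ffunE.
pose co x := xchoose (coordP x).
have coE x : \sum_i co x i *k v i = x by rewrite -(eqP (xchooseP (coordP x))).
have co_uniq c c' : \sum_i c i *k v i = \sum_i c' i *k v i -> forall i, c i = c' i.
  move=> cc' i; apply/eqP; rewrite -subr_eq0; apply/eqP.
  apply: (v_free (fun i => c i - c' i)); have := cc'.
  move/eqP; rewrite -subr_eq0 -sumrB => /eqP {2}<-; apply: eq_bigr => j _.
  by rewrite /Kscale !scalerBl.
have [i yi] : exists i, co y i != 0.
  apply/existsP; apply: contraR y0 => /existsPn y0; apply/eqP.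
  rewrite -(coE y) big1 // => i _; have /negPn/eqP -> := y0 i; exact: Kscale0.
exists (fun x => co x i / co y i); last by rewrite divff.
move=> c x z; rewrite mulrA -mulrDl; congr (_ / _).
apply: (co_uniq (co (c *k x + z)) (fun i => c * co x i + co z i)).
rewrite coE -[in LHS](coE x) -[in LHS](coE z) Kscale_sum -big_split /=.
by apply: eq_bigr => j _; rewrite KscaleDl KscaleA.
Qed.
End Bases.

(** * Homomorphisms and extensions *)
Section HomExt.
Variables (K : fieldType) (n : nat) (n_gt1 : (1 < n)%N).
Local Notation A := (Lambda2 K n_gt1).
Local Notation e := (@idem K n n_gt1).
Local Notation h := (@arr K n n_gt1).
Local Notation S := (@simple_mod K n).
Local Notation P := (@proj_mod K n).
Local Notation "c *k x" := (Kscale c x) (at level 40).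

Lemma simple_fd i : finite_dimensional (S i : lmodType A).
Proof.
exists [:: 1 : K] => x; exists (fun=> x : K).
by rewrite big_ord1 /= -/(Kscale _ _) Kscale_simple mulr1.
Qed.
Lemma proj_fd i : finite_dimensional (P i : lmodType A).
Proof.
exists [:: ((1, 0) : P i); ((0, 1) : P i)] => x.
exists (fun j => if j == 0 :> nat then x.1 else x.2).
rewrite big_ord_recl big_ord1 /= -!/(Kscale _ _) !Kscale_proj /=.
by case: x => a b; congr pair; rewrite /= !mulr0 mulr1 ?addr0 ?add0r.
Qed.

Lemma Hom_iso_K_simple i : Hom_iso_K (S i : lmodType A) (S i).
Proof.
have lin c : linear ((fun s => (c * (s : K) : K)) : (S i : lmodType A) -> S i).
  by move=> a s t; rewrite simple_scaleE mulrDr mulrCA.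
exists (fun c => linear_map (lin c)); split=> [c a b x|a b ab|f].
- by rewrite /= -/(Kscale _ _) Kscale_simple mulrDl mulrA.
- by have := ab (1 : K); rewrite /= !mulr1.
exists (f (1 : K) : K) => x.
by rewrite linear_simpleE Kscale_simple /= mulrC.
Qed.

Lemma Hom_iso_K_proj i : Hom_iso_K (P i : lmodType A) (P i).
Proof.
have lin c : linear ((fun s => (c * s.1, c * s.2)) : (P i : lmodType A) -> P i).
  move=> a s t; rewrite !proj_scaleE /=; congr pair; rewrite /=; ring.
exists (fun c => linear_map (lin c)); split=> [c a b x|a b ab|f].
- by rewrite /= -/(Kscale _ _) Kscale_proj; congr pair; rewrite /=; ring.
- by have := ab ((1, 0) : P i); rewrite /= !mulr1 => -[].
exists (f (top _ i)).1 => x.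
rewrite linear_projE -[f (top _ _)]linear_top_idem idem_proj eqxx ordS_neq //.
rewrite arr_proj eqxx !Kscale_proj; congr pair; rewrite /=; ring.
Qed.

Lemma Hom_zero_simple_simple i j : i != j -> Hom_zero (S i : lmodType A) (S j).
Proof.
move=> ij f x; rewrite linear_simpleE -linear_simple_idem idem_simple.
by rewrite eq_sym (negPf ij) Kscaler0.
Qed.
Lemma Hom_zero_simple_proj i j : i != ordS j -> Hom_zero (S i : lmodType A) (P j).
Proof.
move=> ij f x; rewrite linear_simpleE.
have := linear_simple_arr j f; rewrite arr_proj eqxx => -[f1].
rewrite -linear_simple_idem idem_proj f1 [ordS j == _]eq_sym (negPf ij) if_same.
by rewrite Kscaler0.
Qed.
Lemma Hom_zero_proj_simple i j : i != j -> Hom_zero (P i : lmodType A) (S j).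
Proof.
move=> ij f x; rewrite linear_projE -linear_top_idem idem_simple.
by rewrite eq_sym (negPf ij) scaler0 !Kscaler0 addr0.
Qed.
Lemma Hom_zero_proj_proj i j : i != j -> i != ordS j -> Hom_zero (P i : lmodType A) (P j).
Proof.
move=> ij ij' f x; rewrite linear_projE -linear_top_idem idem_proj.
by rewrite eq_sym (negPf ij) eq_sym (negPf ij') scaler0 !Kscaler0 addr0.
Qed.

Lemma Hom_proj_simple i : ~ Hom_zero (P i : lmodType A) (S i).
Proof.
have e1 : e i *: ((1 : K) : S i) = 1 by rewrite idem_simple eqxx.
move=> /(_ (of_proj e1) (top _ i)) /eqP.
by rewrite of_projE arr_simple Kscaler0 addr0 Kscale1 oner_eq0.
Qed.
Lemma Hom_proj_proj j : ~ Hom_zero (P (ordS j) : lmodType A) (P j).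
Proof.
have e1 : e (ordS j) *: ((0, 1) : P j) = (0, 1) by rewrite idem_proj eqxx if_same.
move=> /(_ (of_proj e1) (top _ _)).
rewrite of_projE arr_proj if_same Kscaler0 addr0 Kscale1 => -[] /eqP.
by rewrite oner_eq0.
Qed.
Lemma Hom_simple_proj j : ~ Hom_zero (S (ordS j) : lmodType A) (P j).
Proof.
have e1 : e (ordS j) *: ((0, 1) : P j) = (0, 1) by rewrite idem_proj eqxx if_same.
have h1 : h (ordS j) *: ((0, 1) : P j) = 0 by rewrite arr_proj if_same.
move=> /(_ (of_simple e1 h1) (1 : K)).
by rewrite of_simpleE Kscale1 => -[] /eqP; rewrite oner_eq0.
Qed.

(** The generator of P_i can be lifted into e_i of the middle term. *)
Lemma Ext1_zero_proj i (N : lmodType A) : Ext1_zero (P i) N.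
Proof.
move=> X; have [z z_out] := ext_out_surj X (top _ i : P i).
have ex : e i *: (e i *: z) = e i *: z by rewrite scalerA idem_idem eqxx.
apply: (@split_by_section _ _ _ _ _ (of_proj ex)) => s.
have ez : ext_out X (e i *: z) = top K i.
  by rewrite linearZZ [ext_out X z]z_out idem_top.
rewrite of_projE linearD !linearK ez [ext_out X (h i *: _)]linearZZ ez.
rewrite arr_proj.
rewrite eqxx. rewrite !Kscale_proj.
case: s => a b; congr pair; rewrite /=; ring.
Qed.

(** P_i is injective: a linear retraction of the middle term on P_i, composed
    with the coordinate of the socle, gives a linear form, and the map to P_i
    that it defines is a retraction of modules. *)
Lemma Ext1_zero_simple_proj i j : Ext1_zero (S j : lmodType A) (P i).
Proof.
move=> X; have [x x_out] := ext_out_surj X ((1 : K) : S j).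
have tP z : exists y, z - (ext_out X z : K) *k x == ext_in X y.
  have /ext_exact [y ->] : ext_out X (z - (ext_out X z : K) *k x) = 0; last by exists y.
  by rewrite linearB linearK x_out Kscale_simple mulr1 subrr.
pose t z := xchoose (tP z).
have tE z : ext_in X (t z) = z - (ext_out X z : K) *k x by rewrite -(eqP (xchooseP (tP z))).
have t_in y : t (ext_in X y) = y.
  by apply: (@ext_in_inj _ _ _ _ X); rewrite tE ext_out_in Kscale0 subr0.
have t_lin c y z : t (c *k y + z) = c *k t y + t z.
  apply: (@ext_in_inj _ _ _ _ X); rewrite linearD linearK !tE linearD linearK Kscale_simple.
  by rewrite KscaleDl -KscaleA opprD addrACA -[- (c *k _)]KscaleN1 [in RHS]KscaleDr 
    -[- ((ext_out X y : K) *k x)]KscaleN1 [c *k ((-1) *k _)]KscaleA [(-1) *k (c *k _)]KscaleA mulrC.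
have phi_lin : Klinear (fun z => (t z).2).
  by move=> c y z; rewrite t_lin Kscale_proj.
apply: (@split_by_retraction _ _ _ _ _ (to_proj i phi_lin)) => y.
rewrite to_projE -!linearZZ !t_in arr_proj idem_proj !eqxx /=.
by case: y.
Qed.

(** A lift in e_i of the generator of S_i is sent by the arrow at [i] to
    e_(i+1) S_j, which is zero if [j <> i + 1]. *)
Lemma Ext1_zero_simple_simple i j : j != ordS i -> Ext1_zero (S i : lmodType A) (S j).
Proof.
move=> ij X; have [z z_out] := ext_out_surj X ((1 : K) : S i).
have ex : e i *: (e i *: z) = e i *: z by rewrite scalerA idem_idem eqxx.
have hx : h i *: (e i *: z) = 0.
  have /ext_exact [y hy] : ext_out X (h i *: (e i *: z)) = 0.
    by rewrite !linearZZ arr_simple.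
  have : e (ordS i) *: (h i *: (e i *: z)) = h i *: (e i *: z).
    by rewrite scalerA idem_arr eqxx.
  by rewrite hy -linearZZ idem_simple (negPf ij) linear0.
apply: (@split_by_section _ _ _ _ _ (of_simple ex hx)) => s.
rewrite of_simpleE linearK [ext_out X _]linearZZ [ext_out X z]z_out idem_simple eqxx.
by rewrite Kscale_simple mulr1.
Qed.

(** The extension P_i does not split, because the arrow at [i] acts nontrivially
    on P_i but trivially on the sum of two simple modules. *)
Lemma Ext1_simple_simple i : ~ Ext1_zero (S i : lmodType A) (S (ordS i)).
Proof.
have lin_in : linear ((fun s => (0, s : K)) : (S (ordS i) : lmodType A) -> P i).
  by move=> a x y; rewrite simple_scaleE proj_scaleE /= !mulr0 add0r; congr pair; rewrite addr0.
have lin_out : linear ((fun s => s.1) : (P i : lmodType A) -> S i).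
  by move=> a x y; rewrite simple_scaleE proj_scaleE.
have in_inj : injective (linear_map lin_in) by move=> x y [].
have out_surj y : exists x, linear_map lin_out x = y by exists ((y, 0) : P i).
have exact x : linear_map lin_out x = 0 <-> exists y, x = linear_map lin_in y.
  by split=> [|[y ->] //]; case: x => a b /= ->; exists b.
move=> /(_ (Extension in_inj out_surj exact)) [f [f_in f_out]].
have top1 : linear_map lin_in (1 : K) = h i *: top K i by rewrite arr_proj eqxx.
have f1 : (1 : K) = (h i *: f (top K i)).1.
  by rewrite -linearZZ -top1; apply: esym (congr1 fst (f_in (1 : K))).
have f0 : (h i *: f (top K i)).1 = 0 by apply: arr_simple.
by move/eqP: (etrans f1 f0); rewrite oner_eq0.
Qed.

End HomExt.

(** * Bricks *)
Section Bricks.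
Variables (K : fieldType) (n : nat) (n_gt1 : (1 < n)%N).
Local Notation A := (Lambda2 K n_gt1).
Local Notation e := (@idem K n n_gt1).
Local Notation h := (@arr K n n_gt1).
Local Notation S := (@simple_mod K n).
Local Notation P := (@proj_mod K n).
Local Notation "c *k x" := (Kscale c x) (at level 40).

Definition vmod (v : bool * 'I_n) : fdmod A :=
  if v.1 then FdMod (@proj_fd K n n_gt1 v.2) else FdMod (@simple_fd K n n_gt1 v.2).

(** The map P_i -> M given by e_i z is injective, and a linear form [phi] that is
    1 at the image of [z] under the arrow defines a retraction M -> P_i.  The
    composite endomorphism of M is a scalar which fixes e_i z, so it is 1. *)
Lemma brick_proj (M : lmodType A) i (z : M) :
  finite_dimensional M -> Hom_iso_K M M -> h i *: z != 0 -> mod_iso M (P i : lmodType A).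
Proof.
move=> M_fd /brick_endo [_ M_endo] hz0.
have [phi phi_lin phi1] := exists_functional M_fd hz0.
pose x := e i *: z.
have ex : e i *: x = x by rewrite scalerA idem_idem eqxx.
have hx : h i *: x = h i *: z by rewrite scalerA arr_idem eqxx.
have e2x : e (ordS i) *: x = 0 by rewrite scalerA idem_idem ordS_neq // scale0r.
have hhx : h i *: (h i *: x) = 0 by rewrite scalerA arr_arr scale0r.
have e2hx : e (ordS i) *: (h i *: x) = h i *: x by rewrite scalerA idem_arr eqxx.
have phi0 := Klinear0 phi_lin.
have fK : cancel (of_proj ex) (to_proj i phi_lin).
  move=> [a b]; rewrite of_projE to_projE /= !scalerDr !Kscale_comm.
  rewrite e2x hhx e2hx !Kscaler0 addr0 add0r !(KlinearZ phi_lin) hx phi1.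
  by rewrite !mulr1.
exists (to_proj i phi_lin), (of_proj ex) => // w.
have [c fc] := M_endo (of_proj ex \o to_proj i phi_lin).
have cx : c *k x = x.
  rewrite /Kscale -fc -[LHS]/(of_proj ex (to_proj i phi_lin x)) to_projE of_projE.
  by rewrite /= e2x hx phi1 phi0 Kscale0 addr0 Kscale1.
have c1 : c = 1.
  by have := KlinearZ phi_lin c (h i *: x); rewrite -Kscale_comm cx hx phi1 mulr1.
by have := fc w; rewrite -/(Kscale _ _) c1 Kscale1.
Qed.

(** If the arrows act by zero, the e_i act by endomorphisms, that is by scalars,
    so that one of them is the identity.  Then every linear map is an
    endomorphism, in particular the projection on the line of a vector [x]. *)
Lemma brick_simple (M : lmodType A) :
  finite_dimensional M -> Hom_iso_K M M -> (forall i (z : M), h i *: z = 0) ->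
  exists i, mod_iso M (S i : lmodType A).
Proof.
move=> M_fd /brick_endo [[x x0] M_endo] h0.
have [i eix] : exists i, e i *: x != 0.
  apply/existsP; apply: contraR x0 => /existsPn x0; apply/eqP.
  rewrite -[x]scale1r -(sum_idem K n_gt1) scaler_suml big1 // => i _.
  by have /negPn/eqP := x0 i.
have a_e (a : A) (z : M) : a *: (e i *: z) = vcoef a i *k (e i *: z).
  by rewrite scale_idemr h0 Kscaler0 addr0.
have e_lin : linear (fun z : M => e i *: z).
  move=> a y z; rewrite scalerDr; congr (_ + _).
  by rewrite a_e -[i]ord_predK scale_ideml h0 Kscaler0 addr0.
have [c ec] := M_endo (linear_map e_lin).
have c1 : c = 1.
  have := a_e (e i) x; rewrite coefsE eqxx Kscale1 => /eqP.
  rewrite [e i *: x in X in X == _]ec -/(Kscale _ _) Kscale_comm -subr_eq0.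
  rewrite -[- (e i *: x)]KscaleN1 -KscaleDl => c1.
  apply/eqP; rewrite -subr_eq0; apply: contraNT eix => c1'.
  by rewrite -[_ *: x]Kscale1 -(mulVf c1') -KscaleA (eqP c1) Kscaler0.
have ez (z : M) : e i *: z = z by have := ec z; rewrite c1 -/(Kscale _ _) Kscale1.
have [phi phi_lin phi1] := exists_functional M_fd x0.
have f_lin : linear (phi : M -> (S i : lmodType A)).
  move=> a y z; rewrite (KlinearD phi_lin); congr (_ + _).
  by rewrite (scale_simple (ez _) (h0 _ _)) (KlinearZ phi_lin).
exists i, (linear_map f_lin), (of_simple (ez x) (h0 i x)) => [z|s].
  have [d fd] := M_endo (of_simple (ez x) (h0 i x) \o linear_map f_lin).
  have d1 : d = 1.
    have := KlinearZ phi_lin d x; rewrite phi1 mulr1 => <-.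
    rewrite /Kscale -fd -[X in phi X]/(of_simple (ez x) (h0 i x) (phi x)) of_simpleE.
    by rewrite (KlinearZ phi_lin) phi1 mulr1.
  by have := fd z; rewrite -/(Kscale _ _) d1 Kscale1.
by rewrite of_simpleE /= (KlinearZ phi_lin) phi1 mulr1.
Qed.

Lemma brick_classification (M : fdmod A) :
  Hom_iso_K M M -> exists v, mod_iso M (vmod v).
Proof.
move=> M_brick; have [[i [z hz]]|h0] := Classical_Prop.classic
  (exists i (z : M), h i *: z != 0).
  by exists (true, i); apply: brick_proj hz => //; apply: fdmodP.
have [|i Mi] := @brick_simple M (@fdmodP _ _ M) M_brick; last by exists (false, i).
move=> i z; apply/eqP; case: eqP => // /eqP hz.
by case: h0; exists i, z.
Qed.

Lemma vmod_weak_exceptional v : weak_exceptional (vmod v).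
Proof.
case: v => [[] i]; split=> /=.
- exact: Hom_iso_K_proj.
- exact: Ext1_zero_proj.
- exact: Hom_iso_K_simple.
- by apply: Ext1_zero_simple_simple; rewrite eq_sym ordS_neq.
Qed.

Lemma vmod_orthogonal x y :
  Hom_zero (vmod x) (vmod y) /\ Ext1_zero (vmod x) (vmod y) <-> (x != y) && ~~ edge x y.
Proof.
split=> [[hom0 ext0]|/andP[xy nxy]].
  apply/andP; split.
    apply/eqP => xy; rewrite -{}xy in hom0 {ext0}.
    have [[z z0] _] := brick_endo (vmod_weak_exceptional x).1.
    by have := hom0 idfun z; move/eqP; rewrite (negPf z0).
  apply/negP; case: x y hom0 ext0 => [[] i] [[] j] /= hom0 ext0 /eqP ij; subst.
  - exact: Hom_proj_proj hom0.
  - exact: Hom_proj_simple hom0.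
  - exact: Hom_simple_proj hom0.
  - exact: Ext1_simple_simple ext0.
case: x y xy nxy => [[] i] [[] j] ij nij.
- by split; [apply: Hom_zero_proj_proj|apply: Ext1_zero_proj].
- by split; [apply: Hom_zero_proj_simple|apply: Ext1_zero_proj].
- by split; [apply: Hom_zero_simple_proj|apply: Ext1_zero_simple_proj].
- by split; [apply: Hom_zero_simple_simple|apply: Ext1_zero_simple_simple].
Qed.

(** For [vmod_iso]: P_i is the only letter on which the arrow at [i] acts
    nontrivially, and among simple modules e_i only acts on S_i. *)
Lemma iso_annihilator (M N : lmodType A) (a : A) :
  mod_iso M N -> (forall z : N, a *: z = 0) -> forall z : M, a *: z = 0.
Proof.
move=> [f [g fK gK]] a0 z; apply: (can_inj fK).
by rewrite linearZZ a0 linear0.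
Qed.

Lemma vmod_iso x y : mod_iso (vmod x) (vmod y) -> x = y.
Proof.
have case_proj i v : mod_iso (vmod (true, i)) (vmod v) -> (true, i) = v.
  move=> iso_v; apply/eqP; apply: contraT => iv.
  have /(iso_annihilator iso_v) /(_ (top K i)) : forall z : vmod v, h i *: z = 0.
    case: v iv {iso_v} => [[] j] ij z; last exact: arr_simple.
    by rewrite [LHS]arr_proj; have [ji|//] := eqVneq j i; rewrite ji eqxx in ij.
  by rewrite [_ *: _]arr_proj eqxx => -[] /eqP; rewrite oner_eq0.
case: x y => [[] i] [[] j]; try exact: case_proj.
  by move=> /mod_isoC /case_proj.
move=> iso_ij; have [-> //|ij] := eqVneq i j.
have /(iso_annihilator iso_ij) /(_ (1 : K)) : forall z : vmod (false, j), e i *: z = 0.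
  by move=> z; rewrite [LHS]idem_simple eq_sym (negPf ij).
by rewrite [_ *: _]idem_simple eqxx => /eqP; rewrite oner_eq0.
Qed.
End Bricks.

(** * From modules to words *)
Section Words.
Variables (K : fieldType) (n : nat) (n_gt1 : (1 < n)%N).
Local Notation A := (Lambda2 K n_gt1).
Local Notation V := (bool * 'I_n)%type.
Local Notation vmod := (@vmod K n n_gt1).

Lemma pair_vmod x y :
  weak_exceptional_pair (vmod x) (vmod y) <-> (y != x) && ~~ edge y x.
Proof.
split=> [[_ _ hom0 ext0]|/(vmod_orthogonal K n_gt1) [hom0 ext0]].
  exact/(vmod_orthogonal K n_gt1).
by split=> //; apply: vmod_weak_exceptional.
Qed.

Lemma pair_iso (M N : fdmod A) x y : mod_iso M (vmod x) -> mod_iso N (vmod y) ->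
  weak_exceptional_pair M N -> weak_exceptional_pair (vmod x) (vmod y).
Proof.
move=> Mx Ny [_ _ hom0 ext0]; split; try exact: vmod_weak_exceptional.
  exact: Hom_zero_iso hom0.
exact: Ext1_zero_iso ext0.
Qed.

Lemma Forall_mem (T : eqType) (Q : T -> Prop) (s : seq T) :
  List.Forall Q s <-> {in s, forall x, Q x}.
Proof.
elim: s => [|x s IHs]; first by split.
split=> [H|H]; first inversion_clear H as [|? ? Qx Qs].
  by move=> y; rewrite inE => /predU1P [->//|ys]; apply: (IHs.1 Qs).
constructor; first by apply: H; rewrite mem_head.
by apply/IHs => y ys; apply: H; rewrite inE ys orbT.
Qed.

Lemma admissible_seq w : weak_exceptional_seq (map vmod w) <-> admissible w.
Proof.
elim: w => [|x w IHw]; first by split=> // _; constructor.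
rewrite /admissible /=; split=> [H|/andP[xw ww]].
  inversion_clear H as [|? ? Hx Hw]; apply/andP; split; last exact/IHw.
  apply/allP => y yw; apply/pair_vmod.
  by move: Hx => /List.Forall_map /Forall_mem; apply.
constructor; last exact/IHw.
by apply/List.Forall_map/Forall_mem => y yw; apply/pair_vmod/(allP xw).
Qed.

(** In a sequence of length one no pair exists, and nothing is known about its
    single member. *)
Lemma weak_exceptional_members (s : seq (fdmod A)) :
  weak_exceptional_seq s -> (1 < size s)%N -> List.Forall (@weak_exceptional K A) s.
Proof.
case: s => [|M [|N s]] // H _; inversion_clear H as [|? ? HM _].
have [[]] : weak_exceptional_pair M N by inversion_clear HM.
constructor=> //.
by apply: List.Forall_impl HM => L [].
Qed.

Lemma word_of_seq (s : seq (fdmod A)) :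
  weak_exceptional_seq s -> (1 < size s)%N ->
  exists2 w, admissible w & seq_iso s (map vmod w).
Proof.
move=> s_wex s_gt1.
have [w sw] : exists w, seq_iso s (map vmod w).
  elim: {s_wex s_gt1} (weak_exceptional_members s_wex s_gt1) => [|M s' [M_brick _] _ [w sw]].
    by exists [::]; constructor.
  by have [v Mv] := brick_classification M_brick; exists (v :: w); constructor.
exists w => //; apply/admissible_seq.
elim: w s sw s_wex {s_gt1} => [|x w IHw] s sw s_wex; first by constructor.
inversion sw as [|M ? s' ? Mx s'w]; subst; inversion_clear s_wex as [|? ? HM Hs'].
constructor; last exact: IHw s'w Hs'.
elim: w s' s'w HM {IHw sw Hs'} => [|y w IH] s' s'w HM; first by constructor.
inversion s'w as [|N ? s'' ? Ny s''w]; subst.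
inversion_clear HM as [|? ? MN HM']; constructor; last exact: IH s''w HM'.
exact: pair_iso MN.
Qed.

Lemma mem_In (T : eqType) (s : seq T) x : x \in s -> List.In x s.
Proof. by elim: s => //= y s IHs; rewrite inE => /predU1P [->|/IHs]; [left|right]. Qed.

Lemma In_mem (T : eqType) (s : seq T) x : List.In x s -> x \in s.
Proof. by elim: s => //= y s IHs [->|/IHs]; rewrite inE ?eqxx // => ->; rewrite orbT. Qed.

Lemma has_size_word w : admissible w -> has_size (map vmod w) (size w).
Proof.
move=> /admissible_uniq w_uniq; exists (fun i => vmod (tnth (in_tuple w) i)); split.
- by move=> i; apply/List.in_map/mem_In/mem_tnth.
- move=> i j /vmod_iso; have x0 := tnth (in_tuple w) i.
  rewrite !(tnth_nth x0) /= => /eqP.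
  by rewrite nth_uniq // => /eqP /val_inj.
- move=> M /List.in_map_iff [x [<- /In_mem xw]]; have /tnthP [i ->] : x \in in_tuple w by [].
  by exists i; apply: mod_iso_refl.
Qed.

Lemma has_size_le s m w : has_size s m -> seq_iso s (map vmod w) -> (m <= size w)%N.
Proof.
move=> [f [f_s f_inj _]] sw.
have /fin_all_exists [g gP] i : exists x, x \in w /\ mod_iso (f i) (vmod x).
  have {f_s f_inj} := f_s i; move: (f i) => N.
  elim: w s sw => [|x w IHw] s sw; inversion_clear sw as [|M ? s' ? Mx s'w] => // -[].
    by move=> <-; exists x; rewrite mem_head.
  by move=> /(IHw _ s'w) [y [yw fy]]; exists y; rewrite inE yw orbT.
rewrite -[m]card_ord cardE -(size_map g); apply: uniq_leq_size => [|x].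
  rewrite map_inj_uniq ?enum_uniq // => i j gij; apply: f_inj.
  apply: mod_iso_trans (gP i).2 _; rewrite gij; exact: mod_isoC (gP j).2.
by move=> /mapP [i _ ->]; case: (gP i).
Qed.

Lemma has_size_gt1 (s : seq (fdmod A)) m : has_size s m -> (1 < m)%N -> (1 < size s)%N.
Proof.
move=> [f [f_s f_inj _]] m_gt1.
pose i0 := Ordinal (ltnW m_gt1); pose i1 := Ordinal m_gt1.
case: s f_s => [|M [|N s]] // f_s; first by case: (f_s i0).
have /(congr1 val) // : i0 = i1.
apply: f_inj; case: (f_s i0) => // <-; case: (f_s i1) => // <-.
exact: mod_iso_refl.
Qed.

(** As [m > 1], sequences of length at most one can neither exceed the bound nor
    be full, so every sequence that matters comes from a word. *)
Lemma count_by_words (m : nat) (ws : seq (seq V)) :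
  (1 < m)%N -> uniq ws -> (0 < size ws)%N ->
  (forall w : seq V, admissible w -> (size w <= m)%N) ->
  (forall w, w \in ws = admissible w && (size w == m)) ->
  sup_size A m /\ num_full A (size ws).
Proof.
move=> m_gt1 ws_uniq ws_gt0 max_w wsE.
have sup_m : sup_size A m.
  split=> [s r s_wex s_r|b].
    have [/leq_trans -> //|r_gt1] := leqP r 1; first exact: ltnW.
    have [w w_adm sw] := word_of_seq s_wex (has_size_gt1 s_r r_gt1).
    exact: leq_trans (has_size_le s_r sw) (max_w _ w_adm).
  case: ws ws_gt0 {ws_uniq} wsE => // w ws _ /(_ w); rewrite mem_head.
  move=> /esym /andP [w_adm /eqP <-]; apply; last exact: has_size_word w_adm.
  exact/admissible_seq.
split=> //; exists (fun i => map vmod (tnth (in_tuple ws) i)); split.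
- move=> i; have := mem_tnth i (in_tuple ws); rewrite wsE => /andP [w_adm /eqP w_m].
  split; first exact/admissible_seq.
  by exists m; split=> //; rewrite -[X in has_size _ X]w_m; apply: has_size_word.
- move=> i j ij; have {ij} : tnth (in_tuple ws) i = tnth (in_tuple ws) j.
    move: (tnth _ i) (tnth _ j) ij => w w'.
    elim: w w' => [|x w IHw] [|y w'] //= H; inversion_clear H as [|? ? ? ? xy ww'] => //.
    by rewrite (vmod_iso xy) (IHw w').
  rewrite !(tnth_nth [::]) /= => /eqP.
  by rewrite nth_uniq // => /eqP /val_inj.
move=> s [s_wex [m' [sup_m' s_m']]].
have m'm : m' = m.
  by apply/eqP; rewrite eqn_leq (sup_m.2 _ sup_m'.1) (sup_m'.2 _ sup_m.1).
rewrite {}m'm in s_m'.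
have [w w_adm sw] := word_of_seq s_wex (has_size_gt1 s_m' m_gt1).
have : w \in in_tuple ws.
  by rewrite wsE w_adm eqn_leq max_w //= (has_size_le s_m' sw).
by case/tnthP => i ws_i; exists i; rewrite -ws_i.
Qed.
End Words.

(** * The count *)
Theorem theorem1p6 (K : fieldType) (n k : nat)
    (n_gt1 : (1 < n)%N) (k_gt0 : (0 < k)%N) :
  (n = (2 * k + 1)%N ->
     sup_size (Lambda2 K n_gt1) (3 * k + 1)%N /\
     num_full (Lambda2 K n_gt1) (2 * k + 1)%N) /\
  (n = (2 * k)%N ->
     sup_size (Lambda2 K n_gt1) (3 * k - 1)%N /\
     exists N : nat,
       num_full (Lambda2 K n_gt1) N /\
       N%:R = (2 * k)%N%:R * (8 ^+ k / 12 - (-1) ^+ k / 3 + 1) :> rat).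
Proof.
split=> n_k.
  have n_gt0 : (0 < n)%N := ltnW n_gt1.
  have ws_size : size [seq arc_word i odd n | i <- enum 'I_n] = n.
    by rewrite size_map size_enum_ord.
  rewrite -[in num_full _ _]n_k -[X in num_full _ X]ws_size.
  apply: count_by_words; rewrite ?ws_size //; first lia.
  - rewrite map_inj_uniq ?enum_uniq // => i j /(congr1 (@missing n)).
    by rewrite !missing_arc // => /set1_inj.
  - by move=> w w_adm; have := balance n_gt1 w_adm; have := missing_gt0 n_gt1 w_adm; lia.
  - move=> w; apply/mapP/idP => [[i _ ->]|/(odd_words n_gt1 _ n_k) [i ->]].
      by apply/(odd_words n_gt1 _ n_k); exists i.
    by exists i; rewrite ?mem_enum.
have [sup_m num_N] : sup_size (Lambda2 K n_gt1) (3 * k - 1) /\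
    num_full (Lambda2 K n_gt1) (size (even_words n k)).
  apply: count_by_words; first lia.
  - exact: even_words_uniq.
  - rewrite size_even_words //; lia.
  - exact: even_max.
  - exact: mem_even_words.
split=> //; exists (size (even_words n k)); split=> //.
have N_count : (size (even_words n k) = 2 * k + k * mask_count 1 (3 * k - 1))%N.
  rewrite size_even_words // -(count_good k) mulnS -mulnA mulnDr mulnCA; lia.
have count_rat : 3 * (mask_count 1 (3 * k - 1))%:R = 8 ^+ k / 2 - 2 * (-1) ^+ k :> rat.
  case: k k_gt0 {n_k sup_m num_N N_count} => // j _.
  rewrite (_ : 3 * j.+1 - 1 = 3 * j + 2)%N; last lia.
  have [count_j _ _] := mask_count_formula j; rewrite exprS.
  have : (3 * mask_count 1 (3 * j + 2))%:R + (4 * odd j)%:R = (4 * 8 ^ j)%:R + 2%:R :> rat.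
    by rewrite -!natrD count_j.
  rewrite !natrM natrX [(-1) ^+ j.+1]exprS -[(-1) ^+ j]signr_odd.
  by case: (odd j); rewrite /= ?expr0 ?expr1 ?mulr0n ?mulr1n; lra.
rewrite N_count natrD !natrM.
have -> : (mask_count 1 (3 * k - 1))%:R = (8 ^+ k / 2 - 2 * (-1) ^+ k) / 3 :> rat.
  by rewrite -count_rat; field.
by field.
Qed.
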